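(* Let $n\ge3$ and $d=2n-3$. The number of lines on a generic degree $d$ hypersurface in $\mathbb{P}(\mathbb{C}^{n+1})$ is $d$ times the number of hyperflexes of a generic degree $d$ hypersurface in $\mathbb{P}(\mathbb{C}^{n})$.
   Context: A hyperflex of a degree $d$ hypersurface $Z_f=(f=0)\subset\mathbb{P}(\mathbb{C}^n)$ is a line $[W]\subset\mathbb{P}(\mathbb{C}^n)$ ($W\subset\mathbb{C}^n$ a 2-dimensional linear subspace) such that $f|_W$ is the $d$-th power of a nonzero linear form on $W$, i.e. a line meeting $Z_f$ in a single point. A line on a hypersurface is a projective line contained in it. ''Generic'' means for all defining polynomials in some nonempty Zariski open subset of the space of homogeneous degree $d$ polynomials. *)

(* Defs.v *)
From mathcomp Require Import all_boot all_order all_algebra.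
From mathcomp Require Import boolp classical_sets functions cardinality.
From mathcomp Require Import mpoly.

Set Implicit Arguments.
Unset Strict Implicit.
Unset Printing Implicit Defensive.

Import GRing.Theory.
Local Open Scope classical_set_scope.
Local Open Scope ring_scope.

Section Hypersurfaces.
(* A closed field is infinite, so polynomials may be compared through the
   functions they induce, also after restriction to a subspace. *)
Variables (K : closedFieldType) (n d : nat).

(* The zero form is included: forms make up the whole vector space of
   homogeneous polynomials of degree d in n variables. *)
Definition hform : Type := dhomog n K d.

Definition evalf (f : hform) (v : 'rV[K]_n) : K :=
  (f : {mpoly K[n]}).@[fun i => v 0 i].

(* The bound d.+1 only serves to make the type of monomials finite. *)
Definition dmonom : finType := {m : 'X_{1..n < d.+1} | mdeg m == d}.

Definition coeffs (f : hform) (i : 'I_#|dmonom|) : K :=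
  (f : {mpoly K[n]})@_(val (val (enum_val i))).

Definition zariski_open (U : set hform) : Prop :=
  exists S : set {mpoly K[#|dmonom|]},
    U = [set f | exists2 G, S G & G.@[coeffs f] != 0].

Definition generically (P : hform -> Prop) : Prop :=
  exists U : set hform, [/\ zariski_open U, U !=set0 & forall f, U f -> P f].

(* A line in the projective space of K^n is a plane W through the origin. *)
Definition is_line (W : {vspace 'rV[K]_n}) : Prop := \dim W = 2%N.

Definition lines_on (f : hform) : set {vspace 'rV[K]_n} :=
  [set W | is_line W /\ forall w, w \in W -> evalf f w = 0].

Definition hyperflexes (f : hform) : set {vspace 'rV[K]_n} :=
  [set W | is_line W /\
    exists l : 'Hom(subvs_of W, K^o),
      l != 0 /\ forall w : subvs_of W, evalf f (vsval w) = (l w : K) ^+ d].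

End Hypersurfaces.

(* Main.v *)
(* If f is a form in n variables without lines, the lines on the cone
   F_f = f - x^d are the graphs of the linear forms s on planes W with
   f|W = s^d, so there are d of them for each hyperflex of f.  It remains to
   compare F_f, which is a special form in n + 1 variables, with a generic one.

   Call a form regular if its lines are simple zeros of the equations for a line
   to lie on it.  As there are as many equations as parameters, the pairs
   (line, form) form a space of the dimension of the space of forms, which can be
   parametrised by the forms themselves; the nonregular pairs make up a
   hypersurface in it, and a count of monomials shows that the image of a
   hypersurface under a polynomial map between spaces of equal dimension lies in
   a hypersurface.  So regularity is generic, and the same argument in the
   space of pairs (f, s) shows that F_f is regular for generic f.

   Over the complex numbers the number of lines is locally constant along paths
   of regular forms, by the implicit function theorem and compactness of the
   Grassmannian.  A complex line minus finitely many points is connected, so all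
   regular forms have the same number of lines. *)
Require Import Defs.
From HB Require Import structures.
From mathcomp Require Import all_boot all_order all_algebra perm.
From mathcomp Require Import boolp classical_sets functions cardinality.
From mathcomp Require Import reals complex.
From mathcomp Require mpoly separable cyclotomic.
From mathcomp Require Import ring zify.

Set Implicit Arguments.
Unset Strict Implicit.
Unset Printing Implicit Defensive.

Import Order.TTheory GRing.Theory Num.Theory.
Local Open Scope ring_scope.

Module LineGeometry.
Import mpoly.

(** * Images of hypersurfaces *)

(** The degree makes both problems square. With n = 2 + k one has d + 1 = 2(k + 1): lines in n + 1
    variables have 2(k + 1) parameters, pairs of a line in n variables and a linear form on it have
    2k + 2, and a binary form of degree d has d + 1 coefficients, tested here by its values at (1,
    0), ..., (1, d). A single Jacobian [jac], with a flag [e] that switches the linear form on,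
    therefore serves both.

    The obstacle is that cones are not generic: the polynomial certifying regularity of forms in n +
    1 variables may vanish at every cone. So regularity is kept as a property of the form itself and
    is proved for cones through pairs; a pencil from a cone to a generic form may start inside the
    zero set of the certificate. The same Jacobian excludes lines on f: there s = 0, and the rows of
    s, multiples of s^(d-1), vanish.

    The analysis is done over any algebraically closed numeric field with the properties
    [compact_discs], [small_powers] and [punctured_connected], which are then checked for the
    complex numbers. *)

Lemma linear_dependence (K : fieldType) (I J : finType) (f : I -> J -> K) :
  (#|J| < #|I|)%N ->
  exists v : I -> K, (exists i, v i != 0) /\ forall j, \sum_i v i * f i j = 0.
Proof.
move=> ltJI.
pose A : 'M[K]_(#|I|, #|J|) := \matrix_(i, j) f (enum_val i) (enum_val j).
have : kermx A != 0.
  rewrite -mxrank_eq0 mxrank_ker -lt0n subn_gt0.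
  exact: leq_ltn_trans (rank_leq_col A) ltJI.
case/matrix0Pn => r [c kerrc].
exists (fun i => kermx A r (enum_rank i)); split.
  by exists (enum_val c); rewrite enum_valK.
move=> j; have /matrixP/(_ r (enum_rank j)) := mulmx_ker A.
rewrite !mxE => ker0; rewrite -[RHS]ker0 (reindex (@enum_val I predT)) /=; last first.
  by apply: onW_bij; exact: enum_val_bij.
by apply: eq_bigr => i _; rewrite !mxE enum_valK enum_rankK.
Qed.

Lemma expnD_leq (a b m : nat) :
  ((a + b) ^ m <= a ^ m + m * b * (a + b) ^ m.-1)%N.
Proof.
elim: m => [|m IH] //.
rewrite [in leqLHS]expnS; apply: leq_trans (leq_mul (leqnn _) IH) _.
case: m {IH} => [|m]; first by rewrite !expn0 /=; lia.
rewrite -!pred_Sn; have := leq_exp2r a (a + b) (ltn0Sn m).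
rewrite leq_addr => leab; move: (expnS a m.+1) (expnS (a + b) m); nia.
Qed.

(** Here [m * D * e] bounds the exponents of a product of m polynomials with exponents at most e,
    each raised to a power below D, and [del] bounds the exponents of the equation of the
    hypersurface. *)
Lemma box_count (m e del : nat) :
  exists D, ((m * D * e + del).+1 ^ m < (m * D * e).+1 ^ m + D ^ m)%N.
Proof.
case: m => [|m]; first by exists 1%N.
(* Since D >= 1, D b bounds q + 1 + del. The error term is then at most (m + 1) del b^m D^m = (D -
   1) D^m, which dictates D. *)
pose b := (m.+1 * e + 1 + del)%N.
set D := (m.+1 * del * b ^ m).+1; exists D; set q := (m.+1 * D * e)%N.
rewrite -addSn; apply: leq_ltn_trans (expnD_leq q.+1 del m.+1) _.
rewrite ltn_add2l -pred_Sn.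
have le1 : ((q.+1 + del) ^ m <= D ^ m * b ^ m)%N.
  rewrite -expnMn; case: (m) => [//|m']; rewrite leq_exp2r // /q /b.
  by have : (1 <= D)%N by []; move: (D) => D'; nia.
apply: leq_ltn_trans (leq_mul (leqnn _) le1) _.
by rewrite mulnCA expnSr ltn_pmul2l ?expn_gt0 // /D.
Qed.

Section Boxes.
Variables (K : fieldType) (m : nat).
Implicit Types (p q : {mpoly K[m]}) (e : nat).

(** Exponents are bounded variable by variable and not in total degree, so that the monomials in a
    box are counted by a plain power. *)
Definition box e p := forall mu, mu \in msupp p -> forall i, (mu i <= e)%N.

Lemma box_exists p : exists e, box e p.
Proof.
exists (msize p) => mu /msize_mdeg_lt/ltnW mup i; apply: leq_trans mup.
by rewrite mdegE (bigD1 i) //= leq_addr.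
Qed.

Lemma boxM e e' p q : box e p -> box e' q -> box (e + e') (p * q).
Proof.
move=> bp bq mu /msuppM_le/allpairsP[[a b] /= [pa qb ->]] i.
by rewrite mnmDE leq_add ?bp ?bq.
Qed.

Lemma box1 e : box e 1.
Proof. by move=> mu; rewrite msupp1 inE => /eqP-> i; rewrite mnm0E. Qed.

Lemma box_exp e p a : box e p -> box (a * e) (p ^+ a).
Proof.
move=> bp; elim: a => [|a IH]; first by rewrite expr0; apply: box1.
by rewrite exprS mulSn; apply: boxM.
Qed.

Lemma box_prod (I : finType) (e : I -> nat) (p : I -> {mpoly K[m]}) :
  (forall i, box (e i) (p i)) -> box (\sum_i e i) (\prod_i p i).
Proof.
move=> bp; elim/big_ind2: _ => //; first exact: box1.
by move=> p1 e1 p2 e2; apply: boxM.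
Qed.

Lemma box_mpolyX (mu : 'X_{1..m}) e : (forall i, mu i <= e)%N -> box e 'X_[mu].
Proof. by move=> le_mu nu; rewrite msuppX inE => /eqP->. Qed.

Lemma box_leq e e' p : (e <= e')%N -> box e p -> box e' p.
Proof. by move=> lee bp mu mup i; apply: leq_trans lee; apply: bp. Qed.

Lemma box_eq0 e p :
  box e p -> (forall c : {ffun 'I_m -> 'I_e.+1}, p@_[multinom (c i : nat) | i < m] = 0) ->
  p = 0.
Proof.
move=> bp p0; apply/mpolyP => mu; rewrite mcoeff0.
have [mup|/memN_msupp_eq0//] := boolP (mu \in msupp p).
have := p0 [ffun i => inord (mu i)]; congr (_ = 0).
by congr (_@__); apply/mnmP => i; rewrite mnmE ffunE inordK // ltnS bp.
Qed.

End Boxes.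

Section BoxSum.
Variables (K : fieldType) (m D : nat) (v : {ffun 'I_m -> 'I_D} -> K).

Definition box_sum : {mpoly K[m]} :=
  \sum_a v a *: 'X_[[multinom (a i : nat) | i < m]].

Lemma box_sum_coeff (a : {ffun 'I_m -> 'I_D}) : box_sum@_[multinom (a i : nat) | i < m] = v a.
Proof.
rewrite /box_sum raddf_sum (bigD1 a) //= mcoeffZ mcoeffX eqxx mulr1 big1 ?addr0 //.
move=> b neq_ba; rewrite mcoeffZ mcoeffX; case: eqP; last by rewrite mulr0.
move=> /mnmP eq_ab; case/eqP: neq_ba; apply/ffunP => i; apply: val_inj.
by have := eq_ab i; rewrite !mnmE.
Qed.

End BoxSum.

Lemma meval_exp_sum (K : fieldType) (m m' D : nat)
    (phi : 'I_m -> {mpoly K[m']}) (v : {ffun 'I_m -> 'I_D} -> K) x :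
  (\sum_a v a *: \prod_i phi i ^+ a i).@[x] = (box_sum v).@[fun i => (phi i).@[x]].
Proof.
rewrite /box_sum !raddf_sum; apply: eq_bigr => a _ /=.
rewrite !mevalZ mevalX; congr (_ * _); rewrite rmorph_prod.
by apply: eq_bigr => i _; rewrite rmorphXn mnmE.
Qed.

(* Let P range over the polynomials with exponents < D and Q over those with
   exponents <= q.  The identity P(phi) + g Q = 0 is a homogeneous linear system
   with D^m + (q+1)^m unknowns; the number of equations is (q+1)^m up to a term
   of order D^(m-1), so there is a nonzero solution when D is large. *)
Lemma image_of_hypersurface (K : fieldType) (m : nat)
    (phi : 'I_m -> {mpoly K[m]}) (g : {mpoly K[m]}) :
  g != 0 -> exists2 P : {mpoly K[m]}, P != 0 &
    forall x, g.@[x] = 0 -> P.@[fun i => (phi i).@[x]] = 0.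
Proof.
move=> g0.
have [e phie] : exists e, forall i, box e (phi i).
  have /choice[e0 he0] := fun i => box_exists (phi i).
  by exists (\max_i e0 i) => i; apply: box_leq (he0 i); apply: leq_bigmax.
have [del gdel] := box_exists g.
have [D ltD] := box_count m e del.
pose q := (m * D * e)%N.
pose A := {ffun 'I_m -> 'I_D}; pose B := {ffun 'I_m -> 'I_q.+1}.
pose C := {ffun 'I_m -> 'I_(q + del).+1}.
pose mon n (c : {ffun 'I_m -> 'I_n}) := [multinom (c i : nat) | i < m].
(* The unknowns are the coefficients of P (left summand) and of Q (right summand). *)
pose basis (i : A + B) : {mpoly K[m]} :=
  match i with inl a => \prod_j phi j ^+ a j | inr c => g * 'X_[mon _ c] end.
have lt_card : (#|{: C}| < #|{: A + B}|)%N.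
  rewrite card_sum !card_ffun !card_ord.
  by rewrite [ltnRHS]addnC.
have [v [[i0 vi0] hv]] :=
  linear_dependence (fun i (c : C) => (basis i)@_(mon _ c)) lt_card.
have basis_box i : box (q + del) (basis i).
  case: i => [a|c] /=.
    apply: (@box_leq _ _ (\sum_j a j * e)) => [|]; last first.
      by apply: box_prod => j; apply: box_exp.
    apply: leq_trans (leq_addr _ _); rewrite -big_distrl leq_mul2r.
    apply/orP; right; rewrite -[m in (m * D)%N]card_ord -sum_nat_const.
    by apply: leq_sum => j _; apply: ltnW.
  rewrite addnC; apply: boxM => //; apply: box_mpolyX => j.
  by rewrite mnmE -ltnS.
have sum0 : \sum_i v i *: basis i = 0.
  apply: (@box_eq0 _ _ (q + del)) => [mu|c]; last first.
    by rewrite raddf_sum /= -[RHS](hv c); apply: eq_bigr => i _; rewrite mcoeffZ.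
  move=> /msupp_sum_le/flattenP[s /mapP[i _ ->]] /msuppZ_le mui.
  exact: basis_box mui.
pose Q := box_sum (fun c => v (inr c)).
have PgQ : \sum_(a : A) v (inl a) *: \prod_j phi j ^+ a j + g * Q = 0.
  rewrite -[RHS]sum0 big_sumType /=; congr (_ + _).
  by rewrite mulr_sumr; apply: eq_bigr => c _; rewrite scalerAr.
exists (box_sum (fun a => v (inl a))); last first.
  move=> x gx; rewrite -meval_exp_sum; move/(congr1 (meval x)): PgQ.
  by rewrite mevalD mevalM gx mul0r addr0 meval0.
(* If P = 0, then g Q = 0, so Q = 0 as g is nonzero, and the relation would be trivial. *)
apply/eqP => P0.
have va a : v (inl a) = 0 by rewrite -(box_sum_coeff (fun a => v (inl a))) P0 mcoeff0.
have Q0 : Q = 0.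
  move: PgQ; rewrite big1 ?add0r => [/eqP|a _]; last by rewrite va scale0r.
  by rewrite mulf_eq0 (negPf g0) => /eqP.
case: i0 vi0 => [a|c]; first by rewrite va eqxx.
by rewrite -(box_sum_coeff (fun c => v (inr c))) -/Q Q0 mcoeff0 eqxx.
Qed.

(** * Forms and polynomial functions of their coefficients *)

Section Interpolation.
Variables (K : numFieldType) (n d : nat).

(** Lagrange interpolation at the nodes 0, ..., d: the weights [w a] extract the coefficient of
    degree a. *)
Lemma inverse_Vandermonde :
  exists w : 'I_d.+1 -> 'I_d.+1 -> K, forall a b : 'I_d.+1,
    \sum_(t < d.+1) w a t * t%:R ^+ b = (a == b)%:R.
Proof.
pose V : 'M[K]_d.+1 := Vandermonde d.+1 (\row_t t%:R).
have Vu : V \in unitmx.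
  rewrite unitmxE unitfE det_Vandermonde; apply/prodf_neq0 => i _.
  apply/prodf_neq0 => j ltij; rewrite !mxE subr_eq0 eqr_nat.
  by rewrite neq_ltn ltij orbT.
exists (fun a t => invmx V t a) => a b.
have /matrixP/(_ b a) := mulmxV Vu; rewrite !mxE eq_sym => <-.
by apply: eq_bigr => t _; rewrite !mxE mulrC.
Qed.

Definition grid_point (tau : {ffun 'I_n -> 'I_d.+1}) : 'rV[K]_n :=
  \row_j (tau j)%:R.

(** Interpolation in each variable separately. It turns a polynomial dependence of the values of a
    form on parameters into a polynomial dependence of its coefficients. *)
Lemma coeff_of_values :
  exists w : {ffun 'I_n -> 'I_d.+1} -> {ffun 'I_n -> 'I_d.+1} -> K,
  forall (p : {mpoly K[n]}) (a : {ffun 'I_n -> 'I_d.+1}), box d p ->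
    p@_[multinom (a i : nat) | i < n] =
    \sum_tau w a tau * p.@[fun j => grid_point tau 0 j].
Proof.
have [w hw] := inverse_Vandermonde.
exists (fun a tau => \prod_j w (a j) (tau j)) => p a boxp.
have pE : p = box_sum (fun b : {ffun 'I_n -> 'I_d.+1} => p@_[multinom (b i : nat) | i < n]).
  apply: subr0_eq; apply: (@box_eq0 _ _ d) => [|c].
    move=> mu /msuppB_le; rewrite mem_cat => /orP[/boxp//|].
    move=> /msupp_sum_le/flattenP[s /mapP[i _ ->]] /msuppZ_le.
    by rewrite msuppX inE => /eqP-> j; rewrite mnmE -ltnS.
  by rewrite mcoeffB box_sum_coeff subrr.
rewrite [in RHS]pE.
transitivity (\sum_(tau : {ffun 'I_n -> 'I_d.+1}) \sum_(b : {ffun 'I_n -> 'I_d.+1})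
    p@_[multinom (b i : nat) | i < n] *
    \prod_j (w (a j) (tau j) * (tau j)%:R ^+ b j)); last first.
  apply: eq_bigr => tau _; rewrite raddf_sum mulr_sumr /=.
  apply: eq_bigr => b _; rewrite mevalZ mevalX mulrCA -big_split /=.
  by congr (_ * _); apply: eq_bigr => j _; rewrite mnmE mxE.
rewrite exchange_big /=; under eq_bigr => b _.
  rewrite -mulr_sumr -(bigA_distr_bigA (fun j t => w (a j) t * t%:R ^+ b j)).
  over.
rewrite (bigD1 a) //= [X in _ + X]big1 => [|b neq_ba].
  by rewrite addr0 big1 ?mulr1 // => j _; rewrite hw eqxx.
have [j neq_j] : exists j, b j != a j.
  apply/existsP; apply: contraR neq_ba => /existsPn eq_ba.
  by apply/eqP/ffunP => j; apply/eqP; have := eq_ba j; rewrite negbK.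
by rewrite (bigD1 j) //= hw eq_sym (negPf neq_j) mul0r mulr0.
Qed.

End Interpolation.

Lemma nonroot (K : numFieldType) (n : nat) (p : {mpoly K[n]}) :
  p != 0 -> exists v : 'I_n -> K, p.@[v] != 0.
Proof.
move=> p0; apply: contrapT => nov; case/eqP: p0.
have [d boxp] := box_exists p.
apply: (box_eq0 boxp) => a.
have [w ->//] := coeff_of_values K n d.
apply: big1 => tau _; suff -> : p.@[fun j => grid_point K tau 0 j] = 0 by rewrite mulr0.
by apply/eqP; apply: contrapT => /negP nz; apply: nov; eexists; exact: nz.
Qed.

Section Coefficients.
Variables (K : closedFieldType) (n d : nat).
Implicit Types (f : hform K n d) (v : 'rV[K]_n).

Definition monom (i : 'I_#|dmonom n d|) : 'X_{1..n} := val (val (enum_val i)).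

Lemma monom_inj : injective monom.
Proof. by move=> i j /val_inj/val_inj/enum_val_inj. Qed.

Lemma mdeg_monom i : mdeg (monom i) = d.
Proof. by apply/eqP; exact: (valP (enum_val i)). Qed.

Lemma monom_le i j : (monom i j <= d)%N.
Proof. by rewrite -[leqRHS](mdeg_monom i) mdegE (bigD1 j) //= leq_addr. Qed.

Lemma monomP mu : mdeg mu = d -> exists i, monom i = mu.
Proof.
move=> mud; have lt_mu : (mdeg mu < d.+1)%N by rewrite mud.
have eq_mu : mdeg (BMultinom lt_mu) == d by rewrite /= mud.
by exists (enum_rank (Sub (BMultinom lt_mu) eq_mu : dmonom n d)); rewrite /monom enum_rankK.
Qed.

Definition form_of (y : 'I_#|dmonom n d| -> K) : hform K n d :=
  \sum_i y i *: indhomog d ('X_[monom i]).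

Lemma form_ofE y : (form_of y : {mpoly K[n]}) = \sum_i y i *: 'X_[monom i].
Proof.
rewrite /form_of raddf_sum; apply: eq_bigr => i _ /=.
by congr (_ *: _); apply: insubdK; rewrite -topredE /= dhomogX /= mdeg_monom.
Qed.

Lemma form_ofK y : coeffs (form_of y) = y.
Proof.
apply/funext => i; rewrite /coeffs form_ofE raddf_sum (bigD1 i) //= big1 ?addr0.
  by rewrite mcoeffZ mcoeffX eqxx mulr1.
move=> j neq_ji; rewrite mcoeffZ mcoeffX -/(monom i) (inj_eq monom_inj).
by rewrite (negPf neq_ji) mulr0.
Qed.

Lemma coeffs_inj f g : coeffs f = coeffs g -> f = g.
Proof.
move=> eq_fg; apply/val_inj/mpolyP => mu /=.
have [mud|mud] := eqVneq (mdeg mu) d; last first.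
  by rewrite !(@dhomog_nemf_coeff _ _ mdeg d) //; apply: dhomog_is_dhomog.
by have [i <-] := monomP mud; exact: (congr1 (@^~ i) eq_fg).
Qed.

Lemma coeffsK f : form_of (coeffs f) = f.
Proof. by apply: coeffs_inj; rewrite form_ofK. Qed.

Lemma hformE f : (f : {mpoly K[n]}) = \sum_i coeffs f i *: 'X_[monom i].
Proof. by rewrite -{1}(coeffsK f) form_ofE. Qed.

Lemma evalfE f v : evalf f v = \sum_i coeffs f i * \prod_j v 0 j ^+ monom i j.
Proof.
rewrite /evalf hformE raddf_sum; apply: eq_bigr => i _ /=.
by rewrite mevalZ mevalX.
Qed.

Definition dform (c : 'I_n) f v : K := (f : {mpoly K[n]})^`M(c).@[fun j => v 0 j].

Lemma dformE c f v :
  dform c f v = \sum_i coeffs f i *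
    ((monom i c)%:R * \prod_j v 0 j ^+ (monom i - U_(c))%MM j).
Proof.
rewrite /dform hformE (raddf_sum (mderiv c)) raddf_sum; apply: eq_bigr => i _ /=.
by rewrite mderivZ mderivX !mevalZ mevalX.
Qed.

Lemma hform_box f : box d f.
Proof.
by move=> mu /(dhomog_mf (dhomog_is_dhomog f)) /= <- i; rewrite mdegE (bigD1 i) ?leq_addr.
Qed.

(** Polynomial dependence on the coefficients of a form; the closure rules below spare writing the
    polynomials out. *)
Definition polyfun (h : hform K n d -> K) : Prop :=
  exists G : {mpoly K[#|dmonom n d|]}, forall f, h f = G.@[coeffs f].

Lemma polyfun_ext h h' : (forall f, h f = h' f) -> polyfun h -> polyfun h'.
Proof. by move=> eq_h [G hG]; exists G => f; rewrite -eq_h. Qed.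

Lemma polyfun_cst c : polyfun (fun=> c).
Proof. by exists c%:MP => f; rewrite mevalC. Qed.

Lemma polyfun_coeffs i : polyfun (fun f => coeffs f i).
Proof. by exists 'X_i => f; rewrite mevalXU. Qed.

Lemma polyfunD h h' : polyfun h -> polyfun h' -> polyfun (fun f => h f + h' f).
Proof. by move=> [G hG] [G' hG']; exists (G + G') => f; rewrite mevalD hG hG'. Qed.

Lemma polyfunM h h' : polyfun h -> polyfun h' -> polyfun (fun f => h f * h' f).
Proof. by move=> [G hG] [G' hG']; exists (G * G') => f; rewrite mevalM hG hG'. Qed.

Lemma polyfunN h : polyfun h -> polyfun (fun f => - h f).
Proof. by move=> [G hG]; exists (- G) => f; rewrite mevalN hG. Qed.

Lemma polyfun_sum (I : Type) (r : seq I) (P : pred I) (h : I -> hform K n d -> K) :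
  (forall i, polyfun (h i)) -> polyfun (fun f => \sum_(i <- r | P i) h i f).
Proof.
move=> /choice[G hG]; exists (\sum_(i <- r | P i) G i) => f.
by rewrite raddf_sum; apply: eq_bigr => i _; rewrite hG.
Qed.

Lemma polyfun_prod (I : Type) (r : seq I) (P : pred I) (h : I -> hform K n d -> K) :
  (forall i, polyfun (h i)) -> polyfun (fun f => \prod_(i <- r | P i) h i f).
Proof.
move=> /choice[G hG]; exists (\prod_(i <- r | P i) G i) => f.
by rewrite rmorph_prod; apply: eq_bigr => i _; rewrite hG.
Qed.

Lemma polyfunX h e : polyfun h -> polyfun (fun f => h f ^+ e).
Proof. by move=> [G hG]; exists (G ^+ e) => f; rewrite rmorphXn /= hG. Qed.

Lemma polyfun_evalf (v : hform K n d -> 'rV[K]_n) :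
  (forall j, polyfun (fun f => v f 0 j)) -> polyfun (fun f => evalf f (v f)).
Proof.
move=> pv; apply: (@polyfun_ext (fun f => \sum_i coeffs f i * \prod_j v f 0 j ^+ monom i j)).
  by move=> f; rewrite evalfE.
apply: polyfun_sum => i; apply: polyfunM; first exact: polyfun_coeffs.
by apply: polyfun_prod => j; apply: polyfunX.
Qed.

Lemma polyfun_dform c (v : hform K n d -> 'rV[K]_n) :
  (forall j, polyfun (fun f => v f 0 j)) -> polyfun (fun f => dform c f (v f)).
Proof.
move=> pv; pose h f := \sum_i coeffs f i *
    ((monom i c)%:R * \prod_j v f 0 j ^+ (monom i - U_(c))%MM j).
apply: (@polyfun_ext h) => [f|]; first by rewrite dformE.
apply: polyfun_sum => i; apply: polyfunM; first exact: polyfun_coeffs.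
apply: polyfunM; first exact: polyfun_cst.
by apply: polyfun_prod => j; apply: polyfunX.
Qed.

Lemma polyfun_det q (A : hform K n d -> 'M[K]_q) :
  (forall i j, polyfun (fun f => A f i j)) -> polyfun (fun f => \det (A f)).
Proof.
move=> pA; rewrite /determinant; apply: polyfun_sum => s.
apply: polyfunM; first exact: polyfun_cst.
exact: polyfun_prod.
Qed.

End Coefficients.

(** * Critical values *)

(** Up to a permutation of rows this is a Vandermonde matrix with distinct nodes. *)
Lemma det_monomials (K : numFieldType) q (sigma : 'I_q -> 'I_q) :
  injective sigma -> \det (\matrix_(r < q, t < q) (t%:R : K) ^+ sigma r) != 0.
Proof.
move=> inj_s; pose V : 'M[K]_q := Vandermonde q (\row_t t%:R).
have -> : \matrix_(r, t) (t%:R : K) ^+ sigma r = row_perm (perm inj_s) V.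
  by apply/matrixP => r t; rewrite !mxE permE.
rewrite row_permE det_mulmx det_perm mulf_neq0 ?signr_eq0 // det_Vandermonde.
apply/prodf_neq0 => i _; apply/prodf_neq0 => j ltij.
by rewrite !mxE subr_eq0 eqr_nat neq_ltn ltij orbT.
Qed.

Section Chart.
Variables (K : numFieldType) (k d : nat).
Implicit Type x : 'rV[K]_d.+1.

(** Entries 2c and 2c + 1 of [x] are the coefficients of a linear form in u and v. The index [c] is
    a natural number so that c = k can denote the linear form s accompanying the line. *)
Definition slope x c (u v : K) : K :=
  u * x 0 (inord c.*2) + v * x 0 (inord c.*2.+1).

(* The vector (u, v) [1 | X], where the row x lists the columns of the
   2 x k matrix X. *)
Definition chart_pt x (u v : K) : 'rV[K]_(2 + k) :=
  row_mx (\row_(i < 2) (if i == 0 then u else v)) (\row_(c < k) slope x c u v).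

Lemma chart_pt0 x u v : chart_pt x u v 0 (lshift k 0) = u.
Proof. by rewrite row_mxEl mxE. Qed.

Lemma chart_pt1 x u v : chart_pt x u v 0 (lshift k 1) = v.
Proof. by rewrite row_mxEl mxE. Qed.

Lemma chart_ptr x u v c : chart_pt x u v 0 (rshift 2 c) = slope x c u v.
Proof. by rewrite row_mxEr mxE. Qed.

End Chart.

Section CriticalValues.
Variables (K : numClosedFieldType) (k d : nat) (e : bool).
Hypothesis hd : d.+1 = (k + e).*2.
Local Notation form := (hform K (2 + k) d).
Local Notation m := #|dmonom (2 + k) d|.
Implicit Types (f : form) (x : 'rV[K]_d.+1).

(* Row r holds the derivatives with respect to x_r of f - s^d at the points
   chart_pt x 1 t for t = 0..d, where s = slope x k, except that the rows
   r >= 2k, which only exist if e = 1, are divided by the constant - d. *)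
Definition jac f x : 'M[K]_d.+1 := \matrix_(r, t)
  (t%:R ^+ odd r *
   if insub r./2 is Some c then dform (rshift 2 c) f (chart_pt k x 1 t%:R)
   else slope x k 1 t%:R ^+ d.-1).

Let u0 : 'I_(2 + k) := lshift k 0.
Let u1 : 'I_(2 + k) := lshift k 1.

(** The d + 1 monomials in the first two variables alone. Their coefficients are the slots in which
    the d + 1 coordinates of [x] are stored. *)
Definition pure_mnm (r : nat) : 'X_{1..2 + k} := (U_(u0) *+ (d - r) + U_(u1) *+ r)%MM.

Lemma pure_mnm_deg (r : 'I_d.+1) : mdeg (pure_mnm r) = d.
Proof. by rewrite mdegD !mdegMn !mdeg1 !mul1n subnK // -ltnS. Qed.

Definition pure (r : 'I_d.+1) : 'I_m := projT1 (cid (monomP (pure_mnm_deg r))).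

Lemma pureE r : monom (pure r) = pure_mnm r.
Proof. exact: projT2 (cid (monomP (pure_mnm_deg r))). Qed.

Lemma pure_mnm1 r : pure_mnm r u1 = r.
Proof. by rewrite mnmDE !mulmnE !mnmE eqxx /=; lia. Qed.

Lemma pure_mnmr r c : pure_mnm r (rshift 2 c) = 0%N.
Proof. by rewrite mnmDE !mulmnE !mnmE. Qed.

Lemma pure_inj : injective pure.
Proof.
by move=> r s /(congr1 (fun i => monom i u1)); rewrite !pureE !pure_mnm1 => /val_inj.
Qed.

Lemma prod_mnm (v : 'rV[K]_(2 + k)) (mu : 'X_{1..2 + k}) :
  \prod_j v 0 j ^+ mu j =
  v 0 u0 ^+ mu u0 * v 0 u1 ^+ mu u1 * \prod_c v 0 (rshift 2 c) ^+ mu (rshift 2 c).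
Proof.
rewrite big_split_ord /= !big_ord_recl big_ord0 mulr1.
by congr (_ * _ * _); congr (v _ _ ^+ mu _); apply: val_inj.
Qed.

Definition slopes f : 'rV[K]_d.+1 := \row_r coeffs f (pure r).

Definition set_slopes x f : form :=
  form_of (fun i => if [pick r | pure r == i] is Some r then x 0 r else coeffs f i).

Lemma slopes_set x f : slopes (set_slopes x f) = x.
Proof.
apply/rowP => r; rewrite mxE form_ofK; case: pickP => [s /eqP/pure_inj->//|].
by move/(_ r); rewrite eqxx.
Qed.

(** Only coefficients of pure monomials change, and these monomials depend on the first two
    coordinates alone. *)
Lemma evalf_set_slopes x f (v v' : 'rV[K]_(2 + k)) :
  v 0 u0 = v' 0 u0 -> v 0 u1 = v' 0 u1 ->
  evalf (set_slopes x f) v - evalf f v = evalf (set_slopes x f) v' - evalf f v'.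
Proof.
move=> eq0 eq1; rewrite !evalfE -!sumrB form_ofK; apply: eq_bigr => i _.
case: pickP => [r /eqP<-|_]; last by rewrite !subrr.
rewrite -!mulrBl; congr (_ * _); rewrite !prod_mnm eq0 eq1; congr (_ * _).
by apply: eq_bigr => c _; rewrite pureE pure_mnmr !expr0.
Qed.

(** Pure monomials have derivative zero in the other variables. Hence the Jacobian of a pair can be
    read off its encoding. *)
Lemma dform_set_slopes c x f v :
  dform (rshift 2 c) (set_slopes x f) v = dform (rshift 2 c) f v.
Proof.
rewrite !dformE form_ofK; apply: eq_bigr => i _.
by case: pickP => [r /eqP<-|_//]; rewrite pureE pure_mnmr mul0r !mulr0.
Qed.

Lemma jac_set_slopes x f x' : jac (set_slopes x f) x' = jac f x'.
Proof.
apply/matrixP => r t; rewrite !mxE; congr (_ * _).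
by case: insubP => // c _ _; rewrite dform_set_slopes.
Qed.

Lemma polyfun_slope c (u v : K) : polyfun (fun f => slope (slopes f) c u v).
Proof.
have pslope i : polyfun (fun f => slopes f 0 i).
  by apply: (@polyfun_ext _ _ _ (fun f => coeffs f (pure i))) => [f|];
    [rewrite mxE | exact: polyfun_coeffs].
by apply: polyfunD; apply: polyfunM => //; exact: polyfun_cst.
Qed.

Lemma polyfun_chart_pt (u v : K) j :
  polyfun (fun f => chart_pt k (slopes f) u v 0 j).
Proof.
have [[i ->]|[c ->]] : (exists i, j = lshift k i) \/ (exists c, j = rshift 2 c).
- by case: (splitP j) => i ji; [left|right]; exists i; apply: val_inj.
- apply: (@polyfun_ext _ _ _ (fun=> if i == 0 then u else v)) => [f|].
    by rewrite row_mxEl mxE.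
  exact: polyfun_cst.
- by apply: polyfun_ext (polyfun_slope c u v) => f; rewrite chart_ptr.
Qed.

Lemma polyfun_jac : polyfun (fun f => \det (jac f (slopes f))).
Proof.
apply: polyfun_det => r t; pose h f : K := t%:R ^+ odd r *
   if insub r./2 is Some c then dform (rshift 2 c) f (chart_pt k (slopes f) 1 t%:R)
   else slope (slopes f) k 1 t%:R ^+ d.-1.
apply: (@polyfun_ext _ _ _ h) => [f|]; first by rewrite mxE.
apply: polyfunM; first exact: polyfun_cst.
case: insubP => [c _ _|_]; last by apply: polyfunX; exact: polyfun_slope.
by apply: polyfun_dform => j; exact: polyfun_chart_pt.
Qed.

(** Linear in the variable [c']: at u = 1 its derivative in that variable is v^(2c). *)
Definition mixed_mnm (c : nat) (c' : 'I_k) : 'X_{1..2 + k} :=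
  (U_(u0) *+ (d.-1 - c.*2) + U_(u1) *+ c.*2 + U_(rshift 2 c'))%MM.

Lemma mixed_mnm_deg (c : 'I_k) : mdeg (mixed_mnm (c + e) c) = d.
Proof. rewrite !mdegD !mdegMn !mdeg1; have := ltn_ord c; lia. Qed.

Definition mixed (c : 'I_k) : 'I_m := projT1 (cid (monomP (mixed_mnm_deg c))).

Lemma mixedE c : monom (mixed c) = mixed_mnm (c + e) c.
Proof. exact: projT2 (cid (monomP (mixed_mnm_deg c))). Qed.

Lemma mixed_mnmr a c c' : mixed_mnm a c (rshift 2 c') = (c == c').
Proof. by rewrite !mnmDE !mulmnE !mnmE /= (inj_eq (@rshift_inj _ _)). Qed.

(* With x = 0 and last slope u, the line is the span of the first two basis
   vectors, f restricts to e u^d on it, and the jacobian of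
   e u^d + \sum_c u^(d-1-2(c+e)) v^(2(c+e)) z_c consists of the monomials of
   degree d in u and v. *)
Lemma regular_form : exists f : form, \det (jac f (slopes f)) != 0.
Proof.
(* If [e] is false, 2k is out of range and [inord] returns 0, but the term using it is then
   multiplied by 0. *)
pose last : 'I_d.+1 := inord k.*2.
exists (form_of (fun i => \sum_c (i == mixed c)%:R + (i == pure last)%:R *+ e)).
set f := form_of _.
have dfE c (v : 'rV[K]_(2 + k)) : v 0 u0 = 1 -> (forall c', v 0 (rshift 2 c') = 0) ->
    dform (rshift 2 c) f v = v 0 u1 ^+ (c + e).*2.
  move=> v0 vr; rewrite dformE form_ofK.
  under eq_bigr => i _ do rewrite mulrDl mulr_suml.
  rewrite big_split /= exchange_big /= [X in _ + X](bigD1 (pure last)) //=.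
  rewrite [X in _ + (_ + X)]big1 ?addr0; last first.
    by move=> i /negPf->; rewrite mul0rn mul0r.
  rewrite pureE pure_mnmr mul0r mulr0 addr0 (bigD1 c) //= [X in _ + X]big1.
    rewrite addr0 (bigD1 (mixed c)) //= [X in _ + X]big1 ?addr0; last first.
      by move=> i /negPf->; rewrite mul0r.
    rewrite eqxx mul1r mixedE mixed_mnmr eqxx mul1r prod_mnm v0 expr1n mul1r.
    rewrite big1 ?mulr1.
      by congr (_ ^+ _); rewrite mnmBE !mnmDE !mulmnE !mnmE eqxx /=; lia.
    move=> c' _; rewrite mnmBE mixed_mnmr mnmE (inj_eq (@rshift_inj _ _)) vr.
    by rewrite subnn expr0.
  move=> c' neq_c; rewrite (bigD1 (mixed c')) //= [X in _ + X]big1 ?addr0; last first.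
    by move=> i /negPf->; rewrite mul0r.
  by rewrite mixedE mixed_mnmr (negPf neq_c) mul0r mulr0.
have slE (r : 'I_d.+1) : slopes f 0 r = (r == last)%:R *+ e.
  rewrite mxE form_ofK (inj_eq pure_inj) big1 ?add0r // => c _.
  case: eqP => // /(congr1 (fun i => monom i (rshift 2 c))).
  by rewrite pureE mixedE pure_mnmr mixed_mnmr eqxx.
have slE' (r : nat) : (r < d.+1)%N -> slopes f 0 (inord r) = (e && (r == k.*2))%:R.
  move=> ltr; rewrite slE -val_eqE /= inordK //.
  case: (e) hd => /= hd'; last by rewrite mulr0n.
  by rewrite mulr1n inordK //; lia.
have sl0 c u v : (c < k)%N -> slope (slopes f) c u v = 0.
  move=> ltck; rewrite /slope !slE'; try lia.
  have /negPf-> : c.*2 != k.*2 by lia.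
  have /negPf-> : c.*2.+1 != k.*2 by lia.
  by rewrite !andbF !mulr0 addr0.
(* The rows of the variables carry the powers r + 2e; the two rows of s, present if [e] is true,
   fill the free exponents 0 and 1. *)
have lt_sigma (r : 'I_d.+1) : ((if r./2 < k then r + e.*2 else r - k.*2) < d.+1)%N.
  have := ltn_ord r; case: ifP; lia.
pose sigma r := Ordinal (lt_sigma r).
have inj_sigma : injective sigma.
  move=> r s /(congr1 val) /=; have := ltn_ord r; have := ltn_ord s => lts ltr.
  by move=> eq_rs; apply: val_inj; move: eq_rs => /=; case: ifP; case: ifP; case: (e) hd => /=; lia.
have -> : jac f (slopes f) = \matrix_(r < d.+1, t < d.+1) (t%:R : K) ^+ sigma r; last by exact: det_monomials.
apply/matrixP => r t; rewrite !mxE /=; case: insubP => [c ltc eqc|/negPf ltc].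
  rewrite ltc dfE ?chart_pt0 // => [|c']; last by rewrite chart_ptr sl0.
  rewrite chart_pt1 -exprD eqc; congr (_ ^+ _).
  by have := odd_double_half r; lia.
rewrite ltc; have ltr := ltn_ord r.
have e1 : e by case: (e) hd ltc ltr => //=; lia.
have -> : slope (slopes f) k 1 t%:R = 1.
  rewrite /slope !slE'; try by move: hd; rewrite e1; lia.
  have /negPf-> : k.*2.+1 != k.*2 by lia.
  by rewrite eqxx e1 mulr1 mulr0 addr0.
rewrite expr1n mulr1; congr (_ ^+ _).
by have := odd_double_half r; move: hd; rewrite e1; lia.
Qed.

(* A form f that restricts to e s^d on the line of x is determined by x and its
   coefficients at the monomials not in the first two variables only.  There are
   as many other monomials as coordinates of x, so a form h encodes such a pair:
   x = slopes h, and f is h - h(u, v, x(u, v)) + e s^d. *)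
Lemma critical_values : exists D : {mpoly K[m]}, D != 0 /\
  forall f x, (forall u v, evalf f (chart_pt k x u v) = slope x k u v ^+ d *+ e) ->
    \det (jac f x) = 0 -> D.@[coeffs f] = 0.
Proof.
have [w hw] := @coeff_of_values K (2 + k) d.
pose expo (i : 'I_m) : {ffun 'I_(2 + k) -> 'I_d.+1} := [ffun j => inord (monom i j)].
have coeffsE f i : coeffs f i = \sum_tau w (expo i) tau * evalf f (grid_point K tau).
  rewrite -hw; last exact: hform_box.
  congr (_@__); apply/mnmP => j; rewrite mnmE ffunE inordK // ltnS.
  exact: monom_le.
pose p (tau : {ffun 'I_(2 + k) -> 'I_d.+1}) f :=
  chart_pt k (slopes f) (grid_point K tau 0 u0) (grid_point K tau 0 u1).
pose s (tau : {ffun 'I_(2 + k) -> 'I_d.+1}) f :=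
  slope (slopes f) k (grid_point K tau 0 u0) (grid_point K tau 0 u1).
(* Coefficient i of the form encoded by [f], interpolated from its values on the grid. Together
   these functions are a polynomial map from the space of forms to itself. *)
pose phi i f := \sum_tau w (expo i) tau *
  (evalf f (grid_point K tau) - evalf f (p tau f) + s tau f ^+ d *+ e).
have /choice[G hG] : forall i, polyfun (phi i).
  move=> i; apply: polyfun_sum => tau; apply: polyfunM; first exact: polyfun_cst.
  apply: polyfunD.
    apply: polyfunD; first by apply: polyfun_evalf => j; exact: polyfun_cst.
    by apply: polyfunN; apply: polyfun_evalf => j; exact: polyfun_chart_pt.
  case: (e) => /=; last exact: polyfun_cst.
  exact: (polyfunX d (polyfun_slope _ _ _)).
have [J hJ] := polyfun_jac.
have J0 : J != 0.
  have [f] := regular_form; rewrite hJ; apply: contraNneq => ->.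
  by rewrite meval0.
have [D D0 hD] := image_of_hypersurface G J0.
exists D; split=> // f x fx detf; pose h := set_slopes x f.
(* The encoding [h] of the pair (x, f) lies on the hypersurface where the Jacobian determinant
   vanishes, and [phi] sends it back to [f]. *)
have := hD (coeffs h); rewrite -hJ slopes_set jac_set_slopes => /(_ detf).
congr (_ = 0); apply: meval_eq => i; rewrite -hG coeffsE.
apply: eq_bigr => tau _; congr (_ * _); rewrite /p /s slopes_set.
have := @evalf_set_slopes x f (grid_point K tau)
  (chart_pt k x (grid_point K tau 0 u0) (grid_point K tau 0 u1)).
rewrite chart_pt0 chart_pt1 fx -/h => /(_ erefl erefl) eq_diff.
by rewrite -[RHS](subKr (evalf h (grid_point K tau))) eq_diff opprB addrA addrAC.
Qed.

End CriticalValues.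

(** * Restriction of forms to lines *)

Section FormAlgebra.
Variables (K : numClosedFieldType) (n d : nat).
Implicit Types (f g : hform K n d) (v : 'rV[K]_n).

Lemma evalfD f g v : evalf (f + g) v = evalf f v + evalf g v.
Proof. exact: mevalD. Qed.

Lemma evalfZ (a : K) f v : evalf (a *: f) v = a * evalf f v.
Proof. exact: mevalZ. Qed.

Lemma evalf_scale f (a : K) v : evalf f (a *: v) = a ^+ d * evalf f v.
Proof.
rewrite !evalfE mulr_sumr; apply: eq_bigr => i _.
rewrite mulrCA; congr (_ * _); under eq_bigr do rewrite mxE exprMn.
rewrite big_split /=; congr (_ * _).
by rewrite prodrXr -mdegE mdeg_monom.
Qed.

Lemma msym_homog (s : 'S_n) f : msym s f \is d.-homog.
Proof.
apply/dhomogP => mu; rewrite mcoeff_msupp mcoeff_sym -mcoeff_msupp.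
by move=> /(dhomog_mf (dhomog_is_dhomog f)) /= <-; rewrite mdeg_mperm.
Qed.

(** Permuting the variables reduces a chart of the Grassmannian with any pivots to the one with
    pivots in the first two coordinates. *)
Definition perm_form (s : 'S_n) f : hform K n d := DHomog (msym_homog s f).

Lemma evalf_perm_form s f v : evalf (perm_form s f) v = evalf f (col_perm s v).
Proof.
rewrite /evalf /= /msym (mmapE (msize f)) // [in RHS](mpolywE (leqnn (msize f))).
rewrite !raddf_sum /=; apply: eq_bigr => mu _.
rewrite mul_mpolyC !mevalZ mevalX; congr (_ * _); rewrite rmorph_prod.
by apply: eq_bigr => i _; rewrite rmorphXn /= mevalXU mxE.
Qed.

Lemma perm_formD s f g : perm_form s (f + g) = perm_form s f + perm_form s g.
Proof. by apply: val_inj; exact: msymD. Qed.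

Lemma perm_formZ s a f : perm_form s (a *: f) = a *: perm_form s f.
Proof. by apply: val_inj; exact: msymZ. Qed.

Lemma polyfun_perm_form s (h : hform K n d -> K) :
  polyfun h -> polyfun (fun f => h (perm_form s f)).
Proof.
move=> [G hG].
have msd (i : 'I_#|dmonom n d|) : mdeg [multinom monom i (s j) | j < n] = d.
  by rewrite mdeg_mperm mdeg_monom.
pose si (i : 'I_#|dmonom n d|) := projT1 (cid (monomP (msd i))).
exists (G \mPo [tuple 'X_(si i) | i < _]) => f.
rewrite hG comp_mpoly_meval; apply: meval_eq => i.
rewrite tnth_mktuple mevalXU /coeffs /= mcoeff_sym; congr (_@__).
by rewrite [RHS](projT2 (cid (monomP (msd i)))).
Qed.

Lemma line_polynomial f (a b : 'rV[K]_n) :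
  exists2 q : {poly K}, (size q <= d.+1)%N & forall t, q.[t] = evalf f (a + t *: b).
Proof.
exists (\sum_i coeffs f i *: \prod_(j < n) (polyC (a 0%R j) + b 0%R j *: polyX K) ^+ monom i j).
  apply: leq_trans (size_sum _ _ _) _; apply/bigmax_leqP => i _.
  apply: leq_trans (size_scale_leq _ _) _.
  rewrite -[in leqRHS](mdeg_monom i) mdegE.
  have sz j : (size ((polyC (a 0%R j) + b 0%R j *: polyX K) ^+ monom i j) <= (monom i j).+1)%N.
    apply: leq_trans (size_poly_exp_leq _ _) _; rewrite ltnS.
    have sz1 : ((size (polyC (a 0%R j) + b 0%R j *: polyX K)%R).-1 <= 1)%N.
      rewrite -subn1 leq_subLR; apply: leq_trans (size_polyD _ _) _.
      rewrite geq_max (leq_trans (size_polyC_leq1 _)) //.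
      by rewrite (leq_trans (size_scale_leq _ _)) // size_polyX.
    by rewrite -[leqRHS]mul1n leq_mul2r sz1 orbT.
  elim/big_ind2: _ => //; first by rewrite size_poly1.
  move=> p e p' e' le1 le2; apply: leq_trans (size_polyMleq _ _) _; lia.
move=> t; rewrite evalfE horner_sum; apply: eq_bigr => i _.
rewrite hornerZ horner_prod; congr (_ * _); apply: eq_bigr => j _.
by rewrite !hornerE !mxE mulrC.
Qed.

(** Along a + t b the form is a polynomial in t of degree at most d with d + 1 roots; homogeneity
    extends the vanishing to all u != 0. *)
Lemma line_vanish f (a b : 'rV[K]_n) :
  (forall t : 'I_d.+1, evalf f (a + t%:R *: b) = 0) ->
  forall u v : K, evalf f (u *: a + v *: b) = 0.
Proof.
have vanish (a' b' : 'rV[K]_n) (c : nat) :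
    (forall i, (i < d.+1)%N -> evalf f (a' + (c + i)%:R *: b') = 0) ->
    forall t, evalf f (a' + t *: b') = 0.
  move=> s0 t; have [q szq hq] := line_polynomial f a' b'.
  pose s := [seq ((c + i)%:R : K) | i <- iota 0 d.+1].
  rewrite -hq (@roots_geq_poly_eq0 _ q s) ?horner0 ?size_map ?size_iota //.
    rewrite all_map; apply/allP => i; rewrite mem_iota => /andP[_ lti] /=.
    by rewrite /root hq s0.
  rewrite map_inj_uniq ?iota_uniq // => i i' /eqP.
  by rewrite eqr_nat eqn_add2l => /eqP.
move=> f0; have f1 t : evalf f (a + t *: b) = 0.
  by apply: (vanish a b 0%N) => i lti; exact: (f0 (Ordinal lti)).
have f2 (u v : K) : u != 0 -> evalf f (u *: a + v *: b) = 0.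
  move=> nzu; have -> : u *: a + v *: b = u *: (a + (v / u) *: b).
    by rewrite scalerDr scalerA mulrCA mulfV // mulr1.
  by rewrite evalf_scale f1 mulr0.
move=> u v; have [->|] := eqVneq u 0; last exact: f2.
(* The point u = 0 is reached along the direction [a], using the parameters 1, ..., d + 1, where u
   is nonzero. *)
rewrite addrC; apply: (vanish _ _ 1%N) => i _.
by rewrite addrC f2 // pnatr_eq0.
Qed.

(* b i is a polynomial divided difference of p in the i-th direction, in the
   variables of two points v and w. *)
Lemma divided_difference (p : {mpoly K[n]}) :
  exists b : 'I_n -> {mpoly K[n + n]}, forall v w : 'rV[K]_n,
    p.@[fun i => w 0 i] - p.@[fun i => v 0 i] =
      \sum_i (w 0 i - v 0 i) * (b i).@[fun j => row_mx v w 0 j] /\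
    forall i, (b i).@[fun j => row_mx v v 0 j] = p^`M(i).@[fun i => v 0 i].
Proof.
pose Q (p : {mpoly K[n]}) := exists b : 'I_n -> {mpoly K[n + n]}, forall v w : 'rV[K]_n,
    p.@[fun i => w 0 i] - p.@[fun i => v 0 i] =
      \sum_i (w 0 i - v 0 i) * (b i).@[fun j => row_mx v w 0 j] /\
    forall i, (b i).@[fun j => row_mx v v 0 j] = p^`M(i).@[fun i => v 0 i].
have QC c : Q c%:MP.
  exists (fun=> 0%:MP) => v w; split=> [|i].
    by rewrite (mevalC _ c) (mevalC _ c) subrr big1 // => i _; rewrite mevalC mulr0.
  have -> : (c%:MP_[n])^`M(i) = 0%:MP by exact: mderivC.
  by rewrite !mevalC.
have QX i : Q 'X_i.
  exists (fun j => (i == j)%:R) => v w; split=> [|j].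
    rewrite !mevalXU (bigD1 i) //= eqxx big1 ?addr0 ?meval1 ?mulr1 // => j.
    by rewrite eq_sym => /negPf->; rewrite meval0 mulr0.
  rewrite mderivX mnm1E mevalZ; case: eqP => [->|_]; last by rewrite meval0 mul0r.
  have -> : (U_(j) - U_(j) = 0 :> 'X_{1..n})%MM.
    by apply/mnmP => l; rewrite mnmBE subnn mnm0E.
  by rewrite mpolyX0 !meval1 mulr1.
have QD p1 p2 : Q p1 -> Q p2 -> Q (p1 + p2).
  move=> [b1 h1] [b2 h2]; exists (fun i => b1 i + b2 i) => v w.
  have [e1 f1] := h1 v w; have [e2 f2] := h2 v w; split=> [|i]; last first.
    by rewrite mderivD !mevalD f1 f2.
  rewrite !mevalD opprD addrACA e1 e2 -big_split; apply: eq_bigr => i _.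
  by rewrite mevalD mulrDr.
have QM p1 p2 : Q p1 -> Q p2 -> Q (p1 * p2).
  move=> [b1 h1] [b2 h2].
  pose fst_ (q : {mpoly K[n]}) : {mpoly K[n + n]} := q \mPo [tuple 'X_(lshift n i) | i < n].
  pose snd_ (q : {mpoly K[n]}) : {mpoly K[n + n]} := q \mPo [tuple 'X_(rshift n i) | i < n].
  have fstE q v w : (fst_ q).@[fun j => row_mx v w 0 j] = q.@[fun i => v 0 i].
    rewrite comp_mpoly_meval; apply: meval_eq => i.
    by rewrite tnth_mktuple mevalXU row_mxEl.
  have sndE q v w : (snd_ q).@[fun j => row_mx v w 0 j] = q.@[fun i => w 0 i].
    rewrite comp_mpoly_meval; apply: meval_eq => i.
    by rewrite tnth_mktuple mevalXU row_mxEr.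
  exists (fun i => snd_ p1 * b2 i + fst_ p2 * b1 i) => v w.
  have [e1 f1] := h1 v w; have [e2 f2] := h2 v w; split=> [|i]; last first.
    by rewrite mderivM !mevalD !mevalM fstE sndE f1 f2 addrC mulrC.
  transitivity (p1.@[fun i => w 0 i] * (p2.@[fun i => w 0 i] - p2.@[fun i => v 0 i]) +
      p2.@[fun i => v 0 i] * (p1.@[fun i => w 0 i] - p1.@[fun i => v 0 i])).
    by rewrite !mevalM; ring.
  rewrite e1 e2 !mulr_sumr -big_split; apply: eq_bigr => i _ /=.
  by rewrite mevalD !mevalM fstE sndE; ring.
suff : Q p by [].
have Q1 : Q 1 by rewrite -mpolyC1; exact: QC.
have QXn i e : Q ('X_i ^+ e).
  by elim: e => [|e IH]; rewrite ?expr0 // exprS; apply: (QM).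
rewrite (mpolyE p); apply: big_ind => [|x y|mu _]; [by rewrite -mpolyC0; exact: QC | exact: QD |].
rewrite -mul_mpolyC; apply: (QM); first exact: QC.
by rewrite mpolyXE_id; apply: big_ind => [|x y|i _]; [exact: Q1 | exact: QM | exact: QXn].
Qed.

End FormAlgebra.

(** * Charts of the Grassmannian of lines *)

Section Planes.
Variables (K : numClosedFieldType) (n : nat).
Implicit Types (a b w : 'rV[K]_n).

Definition plane a b : {vspace 'rV[K]_n} := (<[a]> + <[b]>)%VS.

(** The Plücker coordinates of the span of [a] and [b]. *)
Definition minor a b i j : K := a 0 i * b 0 j - a 0 j * b 0 i.

Lemma mem_plane a b w :
  reflect (exists u v : K, w = u *: a + v *: b) (w \in plane a b).
Proof.
apply: (iffP memv_addP) => [[x /vlineP[u ->] [y /vlineP[v ->] ->]]|[u [v ->]]].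
  by exists u, v.
by exists (u *: a); rewrite ?memvZ ?memv_line //; exists (v *: b); rewrite ?memvZ ?memv_line.
Qed.

Lemma dim_plane a b i j : minor a b i j != 0 -> \dim (plane a b) = 2%N.
Proof.
move=> m0; have a0 : a != 0.
  by apply: contraNneq m0 => ->; rewrite /minor !mxE !mul0r subrr.
have b0 : b != 0.
  by apply: contraNneq m0 => ->; rewrite /minor !mxE !mulr0 subrr.
rewrite /plane dimv_disjoint_sum ?dim_vline ?a0 ?b0 //.
apply/eqP; rewrite -subv0; apply/subvP => w /memv_capP[/vlineP[u ->] /vlineP[v uv]].
have /eqP : u * minor a b i j = 0.
  have ei := congr1 (fun x : 'rV_n => x 0 i) uv; have ej := congr1 (fun x : 'rV_n => x 0 j) uv.
  rewrite !mxE in ei ej.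
  by rewrite /minor mulrBr !mulrA ei ej mulrAC subrr.
by rewrite mulf_eq0 (negPf m0) orbF => /eqP->; rewrite scale0r mem0v.
Qed.

Lemma plane_minor a b : \dim (plane a b) = 2%N -> exists i j, minor a b i j != 0.
Proof.
move=> dim2; apply: contrapT => nomin.
have m0 i j : minor a b i j = 0.
  by apply/eqP; apply: contrapT => /negP mij; apply: nomin; exists i, j.
suff : (\dim (plane a b) <= 1)%N by rewrite dim2.
have le1 c : plane a b = <[c]>%VS -> (\dim (plane a b) <= 1)%N.
  by move=> ->; rewrite dim_vline leq_b1.
have [a0|/rV0Pn[i ai]] := eqVneq a 0.
  apply: (le1 b); apply/vspaceP => w; apply/mem_plane/vlineP => [[u [v ->]]|[v ->]].
    by exists v; rewrite a0 scaler0 add0r.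
  by exists 0, v; rewrite scale0r add0r.
apply: (le1 a); have bE : b = (b 0 i / a 0 i) *: a.
  apply/rowP => j; rewrite mxE mulrAC; apply: (canRL (mulfK ai)).
  by apply/eqP; rewrite -subr_eq0 -oppr_eq0 opprB mulrC [b 0 j * _]mulrC; apply/eqP/m0.
apply/vspaceP => w; apply/mem_plane/vlineP => [[u [v ->]]|[u ->]].
  by rewrite {1}bE scalerA -scalerDl; eexists.
by exists u, 0; rewrite scale0r addr0.
Qed.

Lemma planeP (W : {vspace 'rV[K]_n}) : \dim W = 2%N -> exists a b, W = plane a b.
Proof.
move=> dimW; have := vbasisP W; have := etrans (size_tuple (vbasis W)) dimW.
move: (tval (vbasis W)) => [|a [|b []]] //= _ /andP[/eqP spanW _].
by exists a, b; rewrite -spanW !span_cons span_nil addv0.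
Qed.

Lemma eq_plane (W : {vspace 'rV[K]_n}) a b :
  \dim W = 2%N -> \dim (plane a b) = 2%N -> a \in W -> b \in W -> plane a b = W.
Proof.
move=> dimW dimab aW bW; apply/eqP; rewrite eqEdim dimW dimab leqnn andbT.
by rewrite subv_add -!memvE aW bW.
Qed.

End Planes.

Section ChartLines.
Variables (K : numClosedFieldType) (k d : nat).
Hypothesis hd : d.+1 = k.*2.
Implicit Types (x y : 'rV[K]_d.+1) (g h : 'S_(2 + k)) (w : 'rV[K]_(2 + k)).
Local Notation u0 := (lshift k (0 : 'I_2)).
Local Notation u1 := (lshift k (1 : 'I_2)).

Lemma ord2kP (j : 'I_(2 + k)) : [\/ j = u0, j = u1 | exists c, j = rshift 2 c].
Proof.
case: (splitP j) => i ji; last by apply: Or33; exists i; apply: val_inj.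
by case: i ji => [[|[|//]] lti] /= ji; [apply: Or31|apply: Or32]; apply: val_inj.
Qed.

Lemma chart_ptE x (u v : K) :
  chart_pt k x u v = u *: chart_pt k x 1 0 + v *: chart_pt k x 0 1.
Proof.
apply/rowP => j; rewrite [RHS]mxE [X in X + _]mxE [X in _ + X]mxE.
case: (ord2kP j) => [->|->|[c ->]].
- by rewrite !chart_pt0 mulr1 mulr0 addr0.
- by rewrite !chart_pt1 mulr1 mulr0 add0r.
- by rewrite !chart_ptr /slope; ring.
Qed.

Lemma chart_pt_inj x w : w = chart_pt k x (w 0 u0) (w 0 u1) <->
  forall c, w 0 (rshift 2 c) = slope x c (w 0 u0) (w 0 u1).
Proof.
split=> [wE c|wE]; first by rewrite {1}wE chart_ptr.
apply/rowP => j; case: (ord2kP j) => [->|->|[c ->]].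
- by rewrite chart_pt0.
- by rewrite chart_pt1.
- by rewrite chart_ptr.
Qed.

Lemma col_perm_comb g (u v : K) w w' :
  col_perm g (u *: w + v *: w') = u *: col_perm g w + v *: col_perm g w'.
Proof. by apply/rowP => j; rewrite !mxE. Qed.

Lemma col_permK g : cancel (@col_perm K 1 _ g) (col_perm g^-1%g).
Proof. by move=> w; apply/rowP => j; rewrite !mxE permKV. Qed.

Lemma col_permKV g : cancel (@col_perm K 1 _ g^-1%g) (col_perm g).
Proof. by move=> w; apply/rowP => j; rewrite !mxE permK. Qed.

(** The pivots are the columns [g^-1 u0] and [g^-1 u1]. Indexing by all permutations repeats charts,
    which does no harm as they are finitely many. *)
Definition chart_line g x : {vspace 'rV[K]_(2 + k)} :=
  plane (col_perm g (chart_pt k x 1 0)) (col_perm g (chart_pt k x 0 1)).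

Lemma mem_chart_line g x w :
  reflect (exists u v : K, w = col_perm g (chart_pt k x u v)) (w \in chart_line g x).
Proof.
apply: (iffP (mem_plane _ _ _)) => -[u [v ->]]; exists u, v.
  by rewrite (chart_ptE x u v) col_perm_comb.
by rewrite (chart_ptE x u v) col_perm_comb.
Qed.

Lemma minor_chart_pt x : minor (chart_pt k x 1 0) (chart_pt k x 0 1) u0 u1 = 1.
Proof. by rewrite /minor !chart_pt0 !chart_pt1 mulr1 mulr0 subr0. Qed.

Lemma minor_col_perm g w w' i j :
  minor (col_perm g w) (col_perm g w') i j = minor w w' (g i) (g j).
Proof. by rewrite /minor !mxE. Qed.

Lemma dim_chart_line g x : \dim (chart_line g x) = 2%N.
Proof.
apply: (@dim_plane _ _ _ _ (g^-1%g u0) (g^-1%g u1)).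
by rewrite minor_col_perm !permKV minor_chart_pt oner_neq0.
Qed.

(* Cramer's rule for the coordinates of the span of w and w'. *)
Definition chart_coord w w' : 'rV[K]_d.+1 := \row_r
  if insub r./2 is Some c then
    (if odd r then minor w w' u0 (rshift 2 c) else minor w w' (rshift 2 c) u1)
      / minor w w' u0 u1
  else 0.

Lemma slope_chart_coord w w' (c : 'I_k) (u v : K) : slope (chart_coord w w') c u v =
  (u * minor w w' (rshift 2 c) u1 + v * minor w w' u0 (rshift 2 c)) / minor w w' u0 u1.
Proof.
have ltc := ltn_ord c; rewrite /slope !mxE !inordK; try lia.
rewrite doubleK -[c.*2.+1./2]/(uphalf c.*2) uphalf_double valK /= odd_double /=.
by rewrite [RHS]mulrDl -!mulrA.
Qed.

Lemma plane_chart_coord h w w' : minor w w' u0 u1 != 0 ->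
  plane (col_perm h w) (col_perm h w') = chart_line h (chart_coord w w').
Proof.
move=> m0; apply: eq_plane; first exact: dim_chart_line.
- apply: (@dim_plane _ _ _ _ (h^-1%g u0) (h^-1%g u1)).
  by rewrite minor_col_perm !permKV.
- apply/mem_chart_line; exists (w 0 u0), (w 0 u1); congr (col_perm h _).
  apply/chart_pt_inj => c; rewrite slope_chart_coord.
  by apply: (canRL (mulfK m0)); rewrite /minor; ring.
- apply/mem_chart_line; exists (w' 0 u0), (w' 0 u1); congr (col_perm h _).
  apply/chart_pt_inj => c; rewrite slope_chart_coord.
  by apply: (canRL (mulfK m0)); rewrite /minor; ring.
Qed.

Lemma slope_inj x y :
  (forall (c : 'I_k) (u v : K), slope x c u v = slope y c u v) -> x = y.
Proof.
move=> eq_xy; apply/rowP => r.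
have ltr : (r./2 < k)%N by have := ltn_ord r; lia.
have := eq_xy (Ordinal ltr) 1 0; have := eq_xy (Ordinal ltr) 0 1.
rewrite /slope !mul0r !mul1r !addr0 !add0r /=.
have := odd_double_half r; case: (odd r) => /= rE.
  by rewrite add1n in rE; rewrite rE inord_val.
by rewrite add0n in rE; rewrite rE inord_val.
Qed.

Lemma chart_line_inj g : injective (chart_line g).
Proof.
move=> x y eq_xy; apply: slope_inj => c u v.
have /mem_chart_line[u' [v' eq_w]] : col_perm g (chart_pt k x u v) \in chart_line g y.
  by rewrite -eq_xy; apply/mem_chart_line; exists u, v.
have /(can_inj (col_permK g)) {}eq_w := eq_w.
have := congr1 (fun w => w 0 u0) eq_w; have := congr1 (fun w => w 0 u1) eq_w.
rewrite !chart_pt0 !chart_pt1 => eqv equ; rewrite -!chart_ptr.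
by rewrite eq_w -eqv -equ.
Qed.

Lemma real_argmax (T : finType) (f : T -> K) (t0 : T) :
  exists t, forall s, `|f s| <= `|f t|.
Proof.
suff [t _ maxt] : exists2 t, t \in enum T & forall s, s \in enum T -> `|f s| <= `|f t|.
  by exists t => s; apply: maxt; rewrite mem_enum.
have : enum T != [::] by apply/eqP => e0; have := mem_enum T t0; rewrite e0.
elim: (enum T) => [//|a [|b r] IH] _.
  by exists a; rewrite ?mem_head // => s; rewrite inE => /eqP->.
have [t tr maxt] := IH isT.
have [le_at|lt_ta] := real_leP (normr_real (f a)) (normr_real (f t)).
  exists t; first by rewrite inE tr orbT.
  by move=> s; rewrite inE => /orP[/eqP->//|/maxt].
exists a; first exact: mem_head.
move=> s; rewrite inE => /orP[/eqP->//|/maxt le_st].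
exact: le_trans le_st (ltW lt_ta).
Qed.

Lemma perm_to_pivots (i j : 'I_(2 + k)) : i != j -> exists g : 'S_(2 + k), g i = u0 /\ g j = u1.
Proof.
move=> neq_ij; pose j' := tperm i u0 j.
have neq_j' : j' != u0.
  by rewrite /j' -[X in _ != X](tpermL i u0) (inj_eq perm_inj) eq_sym.
exists (tperm i u0 * tperm j' u1)%g; rewrite !permM tpermL -/j' tpermL; split=> //.
by rewrite tpermD // eq_sym.
Qed.

(* Choosing the pivots of a line at a largest minor bounds its coordinates. *)
Lemma chart_cover (W : {vspace 'rV[K]_(2 + k)}) : \dim W = 2%N ->
  exists g x, W = chart_line g x /\ forall r, `|x 0 r| <= 1.
Proof.
move=> dimW; have [a [b WE]] := planeP dimW.
have [i0 [j0 min0]] : exists i j, minor a b i j != 0 by apply: plane_minor; rewrite -WE.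
have [[i j] maxij] := real_argmax (fun p => minor a b p.1 p.2) (i0, j0).
have minij : minor a b i j != 0.
  rewrite -normr_gt0; apply: lt_le_trans (maxij (i0, j0)).
  by rewrite normr_gt0.
have neq_ij : i != j by apply: contraNneq minij => ->; rewrite /minor mulrC subrr.
have [g [gi gj]] := perm_to_pivots neq_ij.
pose a' := col_perm g^-1%g a; pose b' := col_perm g^-1%g b.
have minE i' j' : minor a' b' i' j' = minor a b (g^-1%g i') (g^-1%g j').
  exact: minor_col_perm.
have gVi : g^-1%g u0 = i by rewrite -gi permK.
have gVj : g^-1%g u1 = j by rewrite -gj permK.
exists g, (chart_coord a' b'); split.
  by rewrite -plane_chart_coord ?minE ?gVi ?gVj // /a' /b' !col_permKV.
move=> r; rewrite mxE; case: insubP => [c _ _|_]; last by rewrite normr0 ler01.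
have minE01 : minor a' b' u0 u1 = minor a b i j by rewrite minE gVi gVj.
rewrite normrM normfV minE01 ler_pdivrMr ?normr_gt0 // mul1r.
by case: ifP => _; rewrite minE; [exact: (maxij (_, _))|exact: (maxij (_, _))].
Qed.

Lemma chart_vanish g x (f : hform K (2 + k) d) :
  (forall w, w \in chart_line g x -> evalf f w = 0) <->
  (forall t : 'I_d.+1, evalf (perm_form g f) (chart_pt k x 1 t%:R) = 0).
Proof.
split=> [f0 t|f0 w /mem_chart_line[u [v ->]]].
  by rewrite evalf_perm_form f0 //; apply/mem_chart_line; exists 1, t%:R.
rewrite -evalf_perm_form chart_ptE; apply: line_vanish => t.
by rewrite -{1}[chart_pt k x 1 0]scale1r -chart_ptE.
Qed.

Definition transition g h x : 'rV[K]_d.+1 := chart_coord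
  (col_perm h^-1%g (col_perm g (chart_pt k x 1 0)))
  (col_perm h^-1%g (col_perm g (chart_pt k x 0 1))).

Definition transition_minor g h x : K := minor
  (col_perm h^-1%g (col_perm g (chart_pt k x 1 0)))
  (col_perm h^-1%g (col_perm g (chart_pt k x 0 1))) u0 u1.

Lemma chart_line_transition g h x : transition_minor g h x != 0 ->
  chart_line g x = chart_line h (transition g h x).
Proof.
by move=> m0; rewrite -plane_chart_coord // !col_permKV.
Qed.

Lemma chart_pt_eq0 g x (u v : K) : col_perm g (chart_pt k x u v) = 0 -> u = 0 /\ v = 0.
Proof.
move=> /(congr1 (col_perm g^-1%g)); rewrite col_permK => w0.
have := congr1 (fun w => w 0 u0) w0; have := congr1 (fun w => w 0 u1) w0.
by rewrite chart_pt0 chart_pt1 !mxE.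
Qed.

(** The minor is the determinant of the base change between the two frames of the common line. Were
    it zero, the columns of the adjugate would give combinations of a frame that vanish. *)
Lemma transition_minor_neq0 g h x y :
  chart_line g x = chart_line h y -> transition_minor g h x != 0.
Proof.
move=> eq_line; rewrite /transition_minor.
set w := col_perm _ _; set w' := col_perm _ _.
have wE u v : col_perm g (chart_pt k x u v) \in chart_line h y.
  by rewrite -eq_line; apply/mem_chart_line; exists u, v.
have /mem_chart_line[p [q e1]] := wE 1 0; have /mem_chart_line[r [s e2]] := wE 0 1.
have minE : minor w w' u0 u1 = p * s - q * r.
  by rewrite /minor /w /w' e1 e2 !col_permK !chart_pt0 !chart_pt1.
apply/eqP; rewrite minE => det0.
have comb u v : col_perm g (chart_pt k x u v) =
    col_perm h (chart_pt k y (u * p + v * r) (u * q + v * s)).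
  rewrite chart_ptE col_perm_comb e1 e2 (chart_ptE y p q) (chart_ptE y r s).
  rewrite (chart_ptE y (_ + _)) !col_perm_comb.
  by rewrite !scalerDr !scalerDl !scalerA addrACA.
(* The combinations (s, -q) and (-r, p) are sent to 0, so all entries of the base change are 0, and
   so is the first basis vector. *)
have [s0 q0] : s = 0 /\ - q = 0.
  apply: (@chart_pt_eq0 g x); rewrite comb.
  have -> : s * p + - q * r = 0 by rewrite mulrC mulNr.
  have -> : s * q + - q * s = 0 by ring.
  by rewrite chart_ptE !scale0r addr0; apply/rowP => j; rewrite !mxE.
have [r0 p0] : - r = 0 /\ p = 0.
  apply: (@chart_pt_eq0 g x); rewrite comb.
  have -> : - r * p + p * r = 0 by ring.
  have -> : - r * q + p * s = 0 by rewrite -det0; ring.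
  by rewrite chart_ptE !scale0r addr0; apply/rowP => j; rewrite !mxE.
have := @chart_pt_eq0 g x 1 0; rewrite e1 p0 -[q]opprK q0 oppr0.
rewrite chart_ptE !scale0r addr0 => -[|/eqP]; last by rewrite oner_eq0.
by apply/rowP => j; rewrite !mxE.
Qed.

Lemma transitionE g h x y : chart_line g x = chart_line h y -> transition g h x = y.
Proof.
move=> eq_line; apply: (@chart_line_inj h).
by rewrite -chart_line_transition // (transition_minor_neq0 eq_line).
Qed.

(** Two distinct lines differ because some basis vector of the first violates an equation of the
    second. Such an inequality of polynomial expressions persists nearby. *)
Lemma neq_chart_line g h x y : chart_line g x != chart_line h y <->
  exists (c : 'I_k) (b : bool),
    let w := col_perm h^-1%g (col_perm g (chart_pt k x b%:R (~~ b)%:R)) in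
    w 0 (rshift 2 c) != slope y c (w 0 u0) (w 0 u1).
Proof.
split=> [|[c [b /= neq_w]]]; last first.
  apply: contraNneq neq_w => eq_line.
  have /mem_chart_line[u [v ->]] :
      col_perm g (chart_pt k x b%:R (~~ b)%:R) \in chart_line h y.
    by rewrite -eq_line; apply/mem_chart_line; eexists; eexists.
  by rewrite col_permK chart_pt0 chart_pt1 chart_ptr.
move=> neq_line; apply: contrapT => nob; case/eqP: neq_line.
have mem (b : bool) : col_perm g (chart_pt k x b%:R (~~ b)%:R) \in chart_line h y.
  rewrite -[col_perm g _](col_permKV h); set w := col_perm h^-1%g _.
  apply/mem_chart_line; exists (w 0 u0), (w 0 u1); congr col_perm.
  apply/chart_pt_inj => c; apply/eqP; apply: contrapT => /negP neq_w.
  by apply: nob; exists c, b.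
by apply: eq_plane; rewrite ?dim_chart_line //; [exact: (mem true)|exact: (mem false)].
Qed.

End ChartLines.

(** * Pencils of forms *)

Section RingClosed.
Variables (K : numClosedFieldType) (Z : Type) (C : (Z -> K) -> Prop).

(** Used both for functions continuous at a point along a filter and for polynomial functions of one
    parameter, so that expressions built from a form are examined only once. *)
Definition ring_closed : Prop :=
  [/\ forall c, C (fun=> c), forall h h', C h -> C h' -> C (fun z => h z + h' z) &
      forall h h', C h -> C h' -> C (fun z => h z * h' z)].

Hypothesis clC : ring_closed.

Lemma closed_cst c : C (fun=> c). Proof. by case: clC. Qed.
Lemma closedD h h' : C h -> C h' -> C (fun z => h z + h' z). Proof. by case: clC => _ CD _; apply: CD. Qed.
Lemma closedM h h' : C h -> C h' -> C (fun z => h z * h' z). Proof. by case: clC => _ _; apply. Qed.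

Lemma closed_ext h h' : (forall z, h z = h' z) -> C h -> C h'.
Proof. by move=> /funext->. Qed.

Lemma closedN h : C h -> C (fun z => - h z).
Proof.
move=> Ch; apply: (@closed_ext (fun z => -1 * h z)) => [z|]; first by rewrite mulN1r.
by apply: closedM => //; exact: closed_cst.
Qed.

Lemma closedB h h' : C h -> C h' -> C (fun z => h z - h' z).
Proof. by move=> Ch Ch'; apply: closedD => //; exact: closedN. Qed.

Lemma closed_sum (I : Type) (r : seq I) (h : I -> Z -> K) :
  (forall i, C (h i)) -> C (fun z => \sum_(i <- r) h i z).
Proof.
move=> Ch; elim: r => [|i r IH].
  by apply: closed_ext (closed_cst 0) => z; rewrite big_nil.
by apply: closed_ext (closedD (Ch i) IH) => z; rewrite big_cons.
Qed.

Lemma closedX h e : C h -> C (fun z => h z ^+ e).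
Proof.
move=> Ch; elim: e => [|e IH]; first exact: (closed_cst 1).
by apply: closed_ext (closedM Ch IH) => z; rewrite exprS.
Qed.

Lemma closed_prod (I : Type) (r : seq I) (h : I -> Z -> K) :
  (forall i, C (h i)) -> C (fun z => \prod_(i <- r) h i z).
Proof.
move=> Ch; elim: r => [|i r IH].
  by apply: closed_ext (closed_cst 1) => z; rewrite big_nil.
by apply: closed_ext (closedM (Ch i) IH) => z; rewrite big_cons.
Qed.

Lemma closed_meval n (p : {mpoly K[n]}) (v : Z -> 'rV[K]_n) :
  (forall i, C (fun z => v z 0 i)) -> C (fun z => p.@[fun i => v z 0 i]).
Proof.
move=> Cv; apply: (@closed_ext
  (fun z => \sum_(m <- msupp p) p@_m * \prod_i v z 0 i ^+ m i)); first by [].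
apply: closed_sum => mu; apply: closedM; first exact: closed_cst.
by apply: closed_prod => i; exact: closedX.
Qed.

Lemma closed_evalf n d (f : hform K n d) (v : Z -> 'rV[K]_n) :
  (forall i, C (fun z => v z 0 i)) -> C (fun z => evalf f (v z)).
Proof. exact: closed_meval. Qed.

Section ChartPoints.
Variables (k d : nat).
Variables (x : Z -> 'rV[K]_d.+1).
Hypothesis Cx : forall r, C (fun z => x z 0 r).

Lemma closed_slope c u v : C u -> C v -> C (fun z => slope (x z) c (u z) (v z)).
Proof. by move=> Cu Cv; apply: closedD; apply: closedM. Qed.

Lemma closed_chart_pt u v j : C u -> C v -> C (fun z => chart_pt k (x z) (u z) (v z) 0 j).
Proof.
move=> Cu Cv; case: (ord2kP j) => [->|->|[c ->]].
- by apply: closed_ext Cu => z; rewrite chart_pt0.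
- by apply: closed_ext Cv => z; rewrite chart_pt1.
- by apply: closed_ext (closed_slope c Cu Cv) => z; rewrite chart_ptr.
Qed.

End ChartPoints.
End RingClosed.

Lemma sum_double (V : zmodType) (k : nat) (G : nat -> V) :
  \sum_(0 <= r < k.*2) G r = \sum_(c < k) (G c.*2 + G c.*2.+1).
Proof.
elim: k => [|k IH]; first by rewrite big_geq // big_ord0.
by rewrite doubleS !big_nat_recr //= big_ord_recr /= IH addrA.
Qed.

Section Differences.
Variables (K : numClosedFieldType) (k d : nat).
Hypothesis hd : d.+1 = k.*2.
Implicit Types (x y : 'rV[K]_d.+1) (f : hform K (2 + k) d).

(** In a chart, the section that [f] defines of the bundle of binary forms of degree d on lines,
    trivialised by the values at d + 1 points. *)
Definition section_vec f x : 'rV[K]_d.+1 := \row_t evalf f (chart_pt k x 1 t%:R).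

(** The divided differences of [f] form a matrix that factors the increment of the section and
    equals the Jacobian on the diagonal. It takes the place of a derivative in the implicit function
    theorem; the last clause provides its continuity. *)
Lemma section_difference f : exists B : 'rV[K]_d.+1 -> 'rV[K]_d.+1 -> 'M[K]_d.+1,
  [/\ forall x y, section_vec f y - section_vec f x = (y - x) *m B x y,
      forall x, B x x = jac f x &
      forall Z C (x y : Z -> 'rV[K]_d.+1), ring_closed C ->
        (forall r, C (fun z => x z 0 r)) -> (forall r, C (fun z => y z 0 r)) ->
        forall r t, C (fun z => B (x z) (y z) r t)].
Proof.
have [b hb] := divided_difference (f : {mpoly K[2 + k]}).
pose q x y (t : 'I_d.+1) := row_mx (chart_pt k x 1 t%:R) (chart_pt k y 1 t%:R).
pose B x y : 'M[K]_d.+1 := \matrix_(r, t) (t%:R ^+ odd r *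
  if insub r./2 is Some c then (b (rshift 2 c)).@[fun j => q x y t 0 j] else 0).
have ltr (r : 'I_d.+1) : (r./2 < k)%N by have := ltn_ord r; lia.
exists B; split=> [x y|x|Z C x y clC Cx Cy r t].
- apply/rowP => t; rewrite [LHS]mxE [X in X + _]mxE [X in _ + X]mxE [X in _ - X]mxE.
  have [-> _] := hb (chart_pt k x 1 t%:R) (chart_pt k y 1 t%:R).
  rewrite big_split_ord /= [X in X + _]big1 ?add0r; last first.
    move=> i _; case: (ord2kP (lshift k i)) => [->|->|[c e]].
    - by rewrite !chart_pt0 subrr mul0r.
    - by rewrite !chart_pt1 subrr mul0r.
    - by move/(congr1 val): e => /= e; have := ltn_ord i; rewrite e.
  rewrite mxE; pose G (r : nat) := (y - x) 0 (inord r) * B x y (inord r) t.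
  transitivity (\sum_(0 <= r < k.*2) G r); last first.
    rewrite big_mkord -hd; apply: eq_bigr => r _.
    by rewrite /G inord_val.
  rewrite sum_double; apply: eq_bigr => c _; have ltc := ltn_ord c.
  rewrite !chart_ptr /G /slope ![B _ _ _ _]mxE !inordK; try lia.
  rewrite doubleK -[c.*2.+1./2]/(uphalf c.*2) uphalf_double valK /= odd_double /=.
  by rewrite !mxE; ring.
- apply/matrixP => r t; rewrite !mxE; congr (_ * _).
  rewrite (@insubT _ (fun i => i < k)%N _ _ (ltr r)) /= /q.
  by have [_ ->] := hb (chart_pt k x 1 t%:R) (chart_pt k x 1 t%:R).
- apply: (@closed_ext _ _ C (fun z => t%:R ^+ odd r *
    (b (rshift 2 (Ordinal (ltr r)))).@[fun j => q (x z) (y z) t 0 j])) => [z|].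
    by rewrite mxE (@insubT _ (fun i => i < k)%N _ _ (ltr r)).
  apply: (closedM clC); first exact: closed_cst.
  apply: (closed_meval clC) => j; case: (splitP j) => i ji.
    have -> : j = lshift _ i by exact: val_inj.
    apply: (@closed_ext _ _ C (fun z => chart_pt k (x z) 1 t%:R 0 i)) => [z|].
      by rewrite row_mxEl.
    by apply: (closed_chart_pt clC) => //; exact: closed_cst.
  have -> : j = rshift _ i by exact: val_inj.
  apply: (@closed_ext _ _ C (fun z => chart_pt k (y z) 1 t%:R 0 i)) => [z|].
    by rewrite row_mxEr.
  by apply: (closed_chart_pt clC) => //; exact: closed_cst.
Qed.

Lemma section_vecD (s : K) f0 f1 x :
  section_vec (f0 + s *: f1) x = section_vec f0 x + s *: section_vec f1 x.
Proof. by apply/rowP => t; rewrite !mxE evalfD evalfZ. Qed.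

Lemma closed_section Z (C : (Z -> K) -> Prop) (s : Z -> K) (x : Z -> 'rV[K]_d.+1) f0 f1 :
  ring_closed C -> C s -> (forall r, C (fun z => x z 0 r)) ->
  forall t, C (fun z => section_vec (f0 + s z *: f1) (x z) 0 t).
Proof.
move=> clC Cs Cx t; have Cf f : C (fun z => section_vec f (x z) 0 t).
  apply: (@closed_ext _ _ C (fun z => evalf f (chart_pt k (x z) 1 t%:R))) => [z|].
    by rewrite mxE.
  apply: (closed_evalf clC) => i.
  by apply: (closed_chart_pt clC) => //; exact: closed_cst.
apply: (@closed_ext _ _ C (fun z => section_vec f0 (x z) 0 t +
  s z * section_vec f1 (x z) 0 t)) => [z|].
  by rewrite section_vecD !mxE.
by apply: (closedD clC) => //; apply: (closedM clC).
Qed.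

Lemma pencil_difference f0 f1 : exists B : K -> 'rV[K]_d.+1 -> 'rV[K]_d.+1 -> 'M[K]_d.+1,
  [/\ forall s x y, section_vec (f0 + s *: f1) y - section_vec (f0 + s *: f1) x =
        (y - x) *m B s x y,
      forall s x, B s x x = jac (f0 + s *: f1) x &
      forall Z C (s : Z -> K) (x y : Z -> 'rV[K]_d.+1), ring_closed C -> C s ->
        (forall r, C (fun z => x z 0 r)) -> (forall r, C (fun z => y z 0 r)) ->
        forall r t, C (fun z => B (s z) (x z) (y z) r t)].
Proof.
have [B0 [e0 j0 c0]] := section_difference f0.
have [B1 [e1 j1 c1]] := section_difference f1.
exists (fun s x y => B0 x y + s *: B1 x y); split=> [s x y|s x|Z C s x y clC Cs Cx Cy r t].
- rewrite !section_vecD mulmxDr -scalemxAr -e0 -e1 scalerBr opprD addrACA.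
  by [].
- rewrite j0 j1; apply/matrixP => r t; rewrite !mxE.
  case: insubP => [c _ _|/negP[]]; last by have := ltn_ord r; lia.
  rewrite mulrCA -mulrDr; congr (_ * _).
  by rewrite /dform -mevalZ -mevalD -mderivZ -mderivD.
- apply: (@closed_ext _ _ C (fun z => B0 (x z) (y z) r t + s z * B1 (x z) (y z) r t)) => [z|].
    by rewrite !mxE.
  by apply: (closedD clC); [exact: c0|apply: (closedM clC) => //; exact: c1].
Qed.

End Differences.

(** * Cones over hypersurfaces *)

Local Notation up := (widen_ord (leqnSn _)).

Lemma ord_upP n (j : 'I_n.+1) : j = ord_max \/ exists i : 'I_n, j = up i.
Proof.
have [lt_jn|le_nj] := ltnP j n; [right | left; apply: val_inj => /=].
  by exists (Ordinal lt_jn); apply: val_inj.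
by have := ltn_ord j; lia.
Qed.

Lemma evalf_inj (K : numClosedFieldType) (n d : nat) (f f' : hform K n d) :
  (forall v, evalf f v = evalf f' v) -> f = f'.
Proof.
move=> eq_f; apply: val_inj; apply: subr0_eq => /=; apply/eqP/negPn/negP.
move=> /nonroot[v]; rewrite mevalB; have := eq_f (\row_i v i); rewrite /evalf.
have row_v : (fun i => (\row_i v i) 0 i) =1 v by move=> i; rewrite mxE.
by rewrite !(meval_eq _ row_v) => ->; rewrite subrr eqxx.
Qed.

Section Cone.
Variables (K : numClosedFieldType) (n d : nat).
Hypothesis d0 : (0 < d)%N.
Implicit Types (f : hform K n d) (v : 'rV[K]_n.+1).

Lemma mdeg_mnmwiden (mu : 'X_{1..n}) : mdeg (mnmwiden mu) = mdeg mu.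
Proof.
rewrite !mdegE big_ord_recr /= mnmwiden_ordmax addn0.
by apply: eq_bigr => i _; rewrite mnmwiden_widen.
Qed.

Lemma cone_homog f : mwiden f - 'X_ord_max ^+ d \is d.-homog.
Proof.
apply: rpredB; last first.
  by rewrite mpolyXn dhomogX /= mdegMn mdeg1 mul1n.
rewrite (hformE f) raddf_sum; apply: rpred_sum => i _ /=.
rewrite mwidenZ mwidenX; apply: rpredZ.
by rewrite dhomogX /= mdeg_mnmwiden mdeg_monom.
Qed.

Definition cone f : hform K n.+1 d := DHomog (cone_homog f).

Definition drop v : 'rV[K]_n := \row_i v 0 (up i).

Lemma meval_mwiden (p : {mpoly K[n]}) v :
  (mwiden p).@[fun j => v 0 j] = p.@[fun i => drop v 0 i].
Proof.
rewrite [in LHS](mpolyE p) [in RHS](mpolyE p) (raddf_sum (@mwiden n K)).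
rewrite (raddf_sum (meval _)) (raddf_sum (meval _)); apply: eq_bigr => mu _ /=.
rewrite mwidenZ mwidenX !mevalZ !mevalX big_ord_recr /= mnmwiden_ordmax mulr1.
by congr (_ * _); apply: eq_bigr => i _; rewrite mnmwiden_widen mxE.
Qed.

Lemma evalf_cone f v : evalf (cone f) v = evalf f (drop v) - v 0 ord_max ^+ d.
Proof. by rewrite /evalf /= mevalB meval_mwiden rmorphXn /= mevalXU. Qed.

Lemma mderiv_mwiden (p : {mpoly K[n]}) (i : 'I_n) :
  (mwiden p)^`M(up i) = mwiden p^`M(i).
Proof.
rewrite (mpolyE p) (raddf_sum (@mwiden n K)) (raddf_sum (mderiv i)) (raddf_sum (mderiv (up i))).
rewrite (raddf_sum (@mwiden n K)); apply: eq_bigr => mu _ /=.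
rewrite mwidenZ mwidenX !mderivZ !mderivX !mwidenZ mwidenX mnmwiden_widen.
congr (_ *: (_ *: 'X_[_])); apply/mnmP => j.
case: (ord_upP j) => [->|[l ->]].
  rewrite mnmBE !mnmwiden_ordmax mnm1E.
  by [].
by rewrite mnmBE !mnmwiden_widen mnmBE !mnm1E.
Qed.

Lemma mderiv_mwiden_last (p : {mpoly K[n]}) : (mwiden p)^`M(ord_max) = 0.
Proof.
rewrite (mpolyE p) (raddf_sum (@mwiden n K)) (raddf_sum (mderiv ord_max)) big1 // => mu _ /=.
by rewrite mwidenZ mwidenX mderivZ mderivX mnmwiden_ordmax scale0r scaler0.
Qed.

Lemma mderiv_last_pow (j : 'I_n.+1) :
  ('X_ord_max ^+ d : {mpoly K[n.+1]})^`M(j) = ((j == ord_max) * d)%:R *: 'X_ord_max ^+ d.-1.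
Proof.
rewrite mpolyXn mderivX mulmnE mnm1E eq_sym; case: eqP => [->|_]; last first.
  by rewrite !mul0n !scale0r.
rewrite !mul1n mpolyXn; congr (_ *: 'X_[_]); apply/mnmP => l.
by rewrite mnmBE !mulmnE mnm1E; case: (_ == _) => /=; lia.
Qed.

Lemma dform_cone f i v : dform (up i) (cone f) v = dform i f (drop v).
Proof.
rewrite /dform /= mderivB mderiv_mwiden mderiv_last_pow.
have /negPf-> : up i != ord_max by rewrite -val_eqE /= ltn_eqF.
by rewrite mul0n scale0r subr0 meval_mwiden.
Qed.

Lemma dform_cone_last f v : dform ord_max (cone f) v = - d%:R * v 0 ord_max ^+ d.-1.
Proof.
rewrite /dform /= mderivB mderiv_mwiden_last mderiv_last_pow eqxx mul1n sub0r.
by rewrite mevalN mevalZ rmorphXn /= mevalXU mulNr.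
Qed.

Definition lift_up (g : 'S_n) : 'S_n.+1 := lift_perm ord_max ord_max g.

Lemma up_lift (i : 'I_n) : up i = lift ord_max i.
Proof. by apply: val_inj; rewrite /= /bump leqNgt ltn_ord. Qed.

Lemma lift_up_up g i : lift_up g (up i) = up (g i).
Proof. by rewrite !up_lift lift_perm_lift. Qed.

Lemma lift_up_max g : lift_up g ord_max = ord_max.
Proof. exact: lift_perm_id. Qed.

Lemma drop_lift_up g v : drop (col_perm (lift_up g) v) = col_perm g (drop v).
Proof. by apply/rowP => i; rewrite !mxE lift_up_up. Qed.

Lemma perm_form_cone g f : perm_form (lift_up g) (cone f) = cone (perm_form g f).
Proof.
apply: evalf_inj => v; rewrite evalf_perm_form !evalf_cone evalf_perm_form.
by rewrite drop_lift_up mxE lift_up_max.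
Qed.

Definition extend (a : 'rV[K]_n) (p : K) : 'rV[K]_n.+1 :=
  \row_j if unlift ord_max j is Some i then a 0 i else p.

Lemma extend_up a p i : extend a p 0 (up i) = a 0 i.
Proof. by rewrite mxE up_lift liftK. Qed.

Lemma extend_last a p : extend a p 0 ord_max = p.
Proof. by rewrite mxE unlift_none. Qed.

Lemma drop_extend a p : drop (extend a p) = a.
Proof. by apply/rowP => i; rewrite mxE extend_up. Qed.

Lemma extend_drop v : extend (drop v) (v 0 ord_max) = v.
Proof.
by apply/rowP => j; case: (ord_upP j) => [->|[i ->]]; rewrite ?extend_last ?extend_up ?mxE.
Qed.

Lemma drop_comb (u w : K) (v v' : 'rV[K]_n.+1) : drop (u *: v + w *: v') = u *: drop v + w *: drop v'.
Proof. by apply/rowP => i; rewrite !mxE. Qed.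

(* The vertex of the cone is not on it, so projecting from it is injective on
   the lines of the cone. *)
Lemma drop_line f (a b : 'rV[K]_n.+1) : lines_on (cone f) (plane a b) ->
  exists i j, minor (drop a) (drop b) i j != 0.
Proof.
move=> [dim2 cone0]; apply: contrapT => no_minor.
have [i [j min_ij]] := plane_minor dim2.
have comb (u v : K) : drop (u *: a + v *: b) = 0 -> u *: a + v *: b = 0.
  move=> drop0; have := cone0 (u *: a + v *: b).
  rewrite evalf_cone drop0 -[X in evalf f X](scale0r (0 : 'rV[K]_n)) evalf_scale.
  rewrite expr0n eqn0Ngt d0 mul0r sub0r => w0.
  have /eqP : - (u *: a + v *: b) 0 ord_max ^+ d = 0 by apply: w0; apply/mem_plane; exists u, v.
  rewrite oppr_eq0 expf_eq0 d0 => /eqP last0.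
  by rewrite -[LHS]extend_drop drop0 last0; apply/rowP => l; rewrite mxE; case: unlift => *; rewrite !mxE.
(* If the projections are dependent, these combinations project to 0, so they are 0 by [comb], and
   [a] and [b] are dependent as well. *)
have dep (l : 'I_n) : b 0 (up l) *: a - a 0 (up l) *: b = 0.
  rewrite -scaleNr; apply: comb; apply/rowP => m; rewrite !mxE.
  have /eqP : minor (drop a) (drop b) l m = 0.
    by apply/eqP; apply: contrapT => /negP nz; apply: no_minor; exists l, m.
  by rewrite /minor !mxE subr_eq0 => /eqP eq_m; rewrite mulNr [b 0 _ * _]mulrC -eq_m subrr.
have min0 (l : 'I_n) m : minor a b (up l) m = 0.
  have := congr1 (fun w : 'rV[K]_n.+1 => w 0 m) (dep l); rewrite !mxE => /eqP.
  by rewrite subr_eq0 /minor => /eqP e; rewrite [a 0 m * _]mulrC e subrr.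
have anti i' j' : minor a b i' j' = - minor a b j' i' by rewrite /minor; ring.
case: (ord_upP i) min_ij => [->|[l ->]]; last by rewrite min0 eqxx.
case: (ord_upP j) => [->|[l ->]]; first by rewrite /minor mulrC subrr eqxx.
by rewrite anti min0 oppr0 eqxx.
Qed.

Lemma cone_line f (a b : 'rV[K]_n) (p q : K) :
  (forall w, w \in plane (extend a p) (extend b q) -> evalf (cone f) w = 0) <->
  (forall u v : K, evalf f (u *: a + v *: b) = (u * p + v * q) ^+ d).
Proof.
have E (u v : K) : evalf (cone f) (u *: extend a p + v *: extend b q) =
    evalf f (u *: a + v *: b) - (u * p + v * q) ^+ d.
  rewrite evalf_cone drop_comb !drop_extend; congr (_ - _ ^+ d).
  by rewrite [LHS]mxE [X in X + _]mxE [X in _ + X]mxE !extend_last.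
split=> [f0 u v|f0 w /mem_plane[u [v ->]]]; last by rewrite E f0 subrr.
by apply: subr0_eq; rewrite -E; apply: f0; apply/mem_plane; exists u, v.
Qed.

(** A linear form on the plane amounts to its values p and q on the basis; conversely the
    coordinates in that basis are linear by Cramer's rule. *)
Lemma hyperflexP f (a b : 'rV[K]_n) : \dim (plane a b) = 2%N ->
  (hyperflexes f (plane a b) <-> exists p q : K, (p, q) != (0, 0) /\
    forall u v : K, evalf f (u *: a + v *: b) = (u * p + v * q) ^+ d).
Proof.
move=> dim2; set W := plane a b.
have aW : a \in W by apply/mem_plane; exists 1, 0; rewrite scale1r scale0r addr0.
have bW : b \in W by apply/mem_plane; exists 0, 1; rewrite scale1r scale0r add0r.
split=> [[_ [l [l0 fl]]]|[p [q [pq0 fpq]]]].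
  pose a' : subvs_of W := vsproj W a; pose b' : subvs_of W := vsproj W b.
  have valE (u v : K) : vsval (u *: a' + v *: b') = u *: a + v *: b.
    by rewrite linearD !linearZ /= !vsprojK.
  have lE (u v : K) : l (u *: a' + v *: b') = u * l a' + v * l b' :> K.
    by rewrite linearD !linearZ.
  exists (l a' : K), (l b' : K); split; last first.
    by move=> u v; rewrite -valE -lE; exact: fl.
  apply: contraNneq l0 => -[la0 lb0]; apply/eqP/lfunP => w; rewrite lfunE /=.
  have /mem_plane[u [v wE]] : vsval w \in W by exact: subvsP.
  have -> : w = u *: a' + v *: b'.
    by apply: val_inj; exact: etrans wE (esym (valE u v)).
  by have := lE u v; rewrite la0 lb0 !mulr0 addr0.
have [i [j m0]] := plane_minor dim2.
pose cu (w : 'rV[K]_n) := minor w b i j / minor a b i j.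
pose cv (w : 'rV[K]_n) := minor a w i j / minor a b i j.
have cE (u v : K) : cu (u *: a + v *: b) = u /\ cv (u *: a + v *: b) = v.
  by split; apply: (canLR (mulfK m0)); rewrite /minor !mxE; ring.
pose l0 (w : subvs_of W) : K^o := cu (vsval w) * p + cv (vsval w) * q.
have l0_linear : linear l0.
  move=> c w w'; rewrite /l0 /cu /cv /minor !linearP /= !mxE /GRing.scale /=; ring.
pose L : {linear subvs_of W -> K^o} :=
  HB.pack l0 (GRing.isLinear.Build K (subvs_of W) K^o _ l0 l0_linear).
split=> //; exists (linfun L); split.
  apply: contraNneq pq0 => L0.
  have La := congr1 (fun l : 'Hom(subvs_of W, K^o) => l (vsproj W a)) L0.
  have Lb := congr1 (fun l : 'Hom(subvs_of W, K^o) => l (vsproj W b)) L0.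
  rewrite !lfunE /= /l0 !vsprojK // in La Lb.
  have [ua va] := cE 1 0; have [ub vb] := cE 0 1.
  rewrite scale1r scale0r addr0 in ua va; rewrite scale1r scale0r add0r in ub vb.
  rewrite ua va mul1r mul0r addr0 in La; rewrite ub vb mul1r mul0r add0r in Lb.
  by rewrite La Lb.
move=> w; have /mem_plane[u [v wE]] : vsval w \in W by exact: subvsP.
by rewrite lfunE /= /l0 wE fpq; have [-> ->] := cE u v.
Qed.

End Cone.

Section FlexCharts.
Variables (K : numClosedFieldType) (k d : nat).
Hypothesis hd : d.+1 = k.+1.*2.
Implicit Types (f : hform K (2 + k) d) (x : 'rV[K]_d.+1) (g : 'S_(2 + k)).
Local Notation u0 := (lshift k (0 : 'I_2)).
Local Notation u1 := (lshift k (1 : 'I_2)).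

Let d_gt0 : (0 < d)%N. Proof. by lia. Qed.

(* Every hyperflex line with a d-th root of the restricted form, and every line
   on f, is reduced in the scheme of pairs (line, d-th root). *)
Definition regular_flex f : Prop := forall g x,
  (forall u v : K, evalf (perm_form g f) (chart_pt k x u v) = slope x k u v ^+ d) ->
  \det (jac (perm_form g f) x) != 0.

Lemma up_lshift (i : 'I_2) : up (lshift k i) = lshift k.+1 i.
Proof. exact: val_inj. Qed.

Lemma up_rshift (c : 'I_k) : up (rshift 2 c) = rshift 2 (up c).
Proof. exact: val_inj. Qed.

Lemma last_rshift : ord_max = rshift 2 (ord_max : 'I_k.+1) :> 'I_(2 + k.+1).
Proof. exact: val_inj. Qed.

Lemma drop_chart_pt x (u v : K) : drop (chart_pt k.+1 x u v : 'rV_(2 + k).+1) = chart_pt k x u v.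
Proof.
apply/rowP => j; rewrite [LHS]mxE; case: (ord2kP j) => [->|->|[c ->]].
- by rewrite up_lshift !chart_pt0.
- by rewrite up_lshift !chart_pt1.
- by rewrite up_rshift !chart_ptr.
Qed.

Lemma chart_pt_last x (u v : K) : chart_pt k.+1 x u v 0 ord_max = slope x k u v.
Proof. by rewrite last_rshift chart_ptr. Qed.

(** The derivative of the cone in the extra coordinate is - d s^(d-1), so the rows of s only get
    back the factor by which [jac] had divided them. *)
Lemma jac_cone f x : \det (jac f x) != 0 -> \det (jac (cone f : hform K (2 + k.+1) d) x) != 0.
Proof.
pose D : 'rV[K]_d.+1 := \row_r (if (r./2 < k)%N then 1 else - d%:R).
have -> : jac (cone f : hform K (2 + k.+1) d) x = diag_mx D *m jac f x.
  apply/matrixP => r t; rewrite mul_diag_mx !mxE.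
  have ltr : (r./2 < k.+1)%N by have := ltn_ord r; lia.
  rewrite (@insubT _ (fun i => i < k.+1)%N _ _ ltr) /=; case: insubP => [c ltc cE|nlt].
    rewrite ltc mul1r; congr (_ * _).
    have -> : rshift 2 (Sub r./2 ltr : 'I_k.+1) = up (rshift 2 c).
      by apply: val_inj; rewrite /= -cE.
    by rewrite (@dform_cone K (2 + k) d d_gt0) drop_chart_pt.
  rewrite (negPf nlt) mulrCA; congr (_ * _).
  have -> : rshift 2 (Sub r./2 ltr : 'I_k.+1) = ord_max.
    by apply: val_inj => /=; lia.
  by rewrite (@dform_cone_last K (2 + k) d d_gt0) chart_pt_last.
rewrite det_mulmx det_diag mulf_eq0 negb_or => ->; rewrite andbT.
apply/prodf_neq0 => r _; rewrite mxE; case: ifP => _; first exact: oner_neq0.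
by rewrite oppr_eq0 pnatr_eq0 -lt0n.
Qed.

(** The projection of the line from the vertex is still a line, so pivots can be found among the old
    coordinates. In such a chart the extra coordinate is the linear form s. *)
Lemma line_chart f (W : {vspace 'rV[K]_(2 + k.+1)}) : lines_on (cone f : hform K (2 + k.+1) d) W ->
  exists g x, W = chart_line (lift_up g : 'S_(2 + k.+1)) x /\
    forall u v : K, evalf (perm_form g f) (chart_pt k x u v) = slope x k u v ^+ d.
Proof.
move=> FW; have [a [b WE]] := planeP FW.1.
have [i [j min_ij]] : exists i j, minor (drop (a : 'rV_(2 + k).+1)) (drop (b : 'rV_(2 + k).+1)) i j != 0.
  by apply: (drop_line d_gt0 (f := f)); rewrite -[plane _ _]WE.
have neq_ij : i != j by apply: contraNneq min_ij => ->; rewrite /minor mulrC subrr.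
have [g [gi gj]] := perm_to_pivots neq_ij.
pose G : 'S_(2 + k.+1) := lift_up g.
pose a' := col_perm G^-1%g a; pose b' := col_perm G^-1%g b.
have GV i' : G^-1%g (up (g i') : 'I_(2 + k.+1)) = up i'.
  by apply: (canLR (permK G)); exact: (esym (@lift_up_up (2 + k) g i')).
have min0 : minor a' b' (lshift k.+1 0) (lshift k.+1 1) != 0.
  move: min_ij; rewrite -!up_lshift -gi -gj /a' /b' minor_col_perm !GV.
  by rewrite /minor !mxE.
pose x : 'rV[K]_d.+1 := chart_coord d a' b'; exists g, x.
have WE' : W = chart_line G x.
  by rewrite /x -(plane_chart_coord hd) // /a' /b' !col_permKV.
split=> // u v.
have /eqP : evalf (cone f : hform K (2 + k.+1) d) (col_perm G (chart_pt k.+1 x u v)) = 0.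
  by apply: FW.2; rewrite WE'; apply/mem_chart_line; exists u, v.
rewrite -evalf_perm_form perm_form_cone evalf_cone drop_chart_pt chart_pt_last subr_eq0.
by move/eqP.
Qed.

Lemma regular_cone f (W : {vspace 'rV[K]_(2 + k.+1)}) : regular_flex f ->
  lines_on (cone f : hform K (2 + k.+1) d) W -> exists (g : 'S_(2 + k.+1)) x,
  W = chart_line g x /\ \det (jac (perm_form g (cone f : hform K (2 + k.+1) d)) x) != 0.
Proof.
move=> reg FW; have [g [x [WE fx]]] := line_chart FW.
exists (lift_up g), x; split=> //; rewrite perm_form_cone; apply: jac_cone.
exact: reg.
Qed.

(** Were both values zero, s would vanish on the line, and so would the rows s^(d-1) of the
    Jacobian, as d > 1. Thus every line on the cone lies over a genuine hyperflex. *)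
Lemma cone_line_root f (a b : 'rV[K]_(2 + k)) (p q : K) : (0 < k)%N -> regular_flex f ->
  lines_on (cone f) (plane (extend a p) (extend b q)) -> (p, q) != (0, 0).
Proof.
move=> k0 reg FW; have [g [x [WE fx]]] := line_chart FW.
apply/eqP => -[p0 q0]; have := reg g x fx; apply/negP; rewrite negbK.
have slope0 u v : slope x k u v = 0.
  rewrite -chart_pt_last -[ord_max in LHS](lift_up_max g).
  have : col_perm (lift_up g : 'S_(2 + k.+1)) (chart_pt k.+1 x u v) \in plane (extend a p) (extend b q).
    by rewrite WE; apply/mem_chart_line; exists u, v.
  move=> /mem_plane[u' [v' /(congr1 (fun w : 'rV[K]_(2 + k).+1 => w 0 ord_max))]].
  rewrite [LHS]mxE => ->.
  by rewrite p0 q0 !mxE !unlift_none !mulr0 addr0.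
pose r : 'I_d.+1 := inord k.*2.
have rE : r./2 = k by rewrite inordK ?doubleK //; lia.
rewrite (expand_det_row _ r) big1 // => t _; rewrite mxE rE slope0.
case: insubP => [c|_]; first by rewrite ltnn.
rewrite expr0n; have /negPf-> : d.-1 != 0%N by lia.
by rewrite mulr0 mul0r.
Qed.

End FlexCharts.

End LineGeometry.

From mathcomp Require Import filter topology normedtype.
Import numFieldNormedType.Exports.
Import (canonicals, coercions) mpoly.
Import LineGeometry.
Local Open Scope classical_set_scope.

(** * The implicit function theorem *)

Section Filters.
Variables (K : numClosedFieldType) (Z : Type) (F : set_system Z) (FF : Filter F) (z0 : Z).

(** The filter is arbitrary, so that neighbourhoods and products of neighbourhood filters are
    treated alike. *)
Definition cont (h : Z -> K) : Prop := h @ F --> h z0.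

Lemma cont_ring_closed : ring_closed cont.
Proof.
split=> [c|h h' ch ch'|h h' ch ch']; first exact: cvg_cst.
- exact: cvgD.
- exact: cvgM.
Qed.

Lemma cont_near_neq0 h : cont h -> h z0 != 0 -> \forall z \near F, h z != 0.
Proof. by move=> ch h0; exact: cvgr_neq0 ch h0. Qed.

Lemma cont_near_dist h e : cont h -> 0 < e -> \forall z \near F, `|h z - h z0| < e.
Proof. by move=> /cvgrPdist_lt ch /ch; apply: filterS => z; rewrite distrC. Qed.

Lemma cont_div h h' : cont h -> cont h' -> h' z0 != 0 -> cont (fun z => h z / h' z).
Proof. by move=> ch ch' h0; apply: cvgM => //; exact: cvgV. Qed.

End Filters.

Section Rows.
Variables (K : numClosedFieldType) (q : nat).
Implicit Types (x y : 'rV[K]_q).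

Definition close (e : K) x y : Prop := forall r, `|y 0 r - x 0 r| < e.

Lemma nbhs_close x (P : set 'rV[K]_q) : (\forall y \near x, P y) ->
  exists2 e : K, 0 < e & forall y, close e x y -> P y.
Proof.
move=> /nbhs_ballP[e /= e0 xP]; exists e => // y xy; apply: xP; split=> // i r.
by rewrite (ord1 i) /ball /= distrC; exact: xy.
Qed.

Lemma cont_coord x r : cont (nbhs x) x (fun y => y 0 r).
Proof. exact: coord_continuous. Qed.

Lemma cont_prod_coord (T : Type) (F : set_system T) (t0 : T) x r : Filter F ->
  cont (filter_prod (nbhs x) F) (x, t0) (fun z => z.1 0 r).
Proof.
move=> FF; apply: (@cvg_comp _ _ _ fst (fun y : 'rV[K]_q => y 0 r) _ (nbhs x)).
  exact: cvg_fst.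
exact: coord_continuous.
Qed.

End Rows.

Section Compactness.
Variable K : numClosedFieldType.

Definition compact_discs : Prop := forall c r : K, compact [set x : K | `|x - c| <= r].

Definition polydisc q (x : 'rV[K]_q) (e : K) : set 'rV[K]_q :=
  [set y | forall r, `|y 0 r - x 0 r| <= e].

Lemma polydisc_compact q (x : 'rV[K]_q) e : compact_discs -> compact (polydisc x e).
Proof. by move=> cK; apply: (@rV_compact K q (fun r => [set y | `|y - x 0 r| <= e])). Qed.

(** The Archimedean property, in the form that makes the Newton steps tend to 0. *)
Definition small_powers : Prop := forall e : K, 0 < e -> exists n, (2^-1 : K) ^+ n < e.

End Compactness.

(** The order of the field is partial, but positive elements are real and therefore comparable. *)
Lemma pos_min (K : numClosedFieldType) (a b : K) : 0 < a -> 0 < b ->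
  exists c : K, [/\ 0 < c, c < a & c < b].
Proof.
move=> a0 b0; have half0 (c : K) : 0 < c -> c / 2 < c.
  by move=> c0; rewrite ltr_pdivrMr // ltr_pMr // ltr1n.
have /comparable_leP[le_ab|lt_ba] : a >=< b by rewrite real_comparable // gtr0_real.
  exists (a / 2); rewrite divr_gt0 // half0 //; split=> //.
  exact: lt_le_trans (half0 _ a0) le_ab.
exists (b / 2); rewrite divr_gt0 // half0 //; split=> //.
exact: lt_trans (half0 _ b0) lt_ba.
Qed.

Section ImplicitFunction.
Variables (K : numClosedFieldType).
Hypothesis (cK : compact_discs K) (sK : small_powers K).
Variables (q : nat) (S : Type) (F : set_system S) (FF : Filter F) (s0 : S).
Variables (Psi : S -> 'rV[K]_q -> 'rV[K]_q) (B : S -> 'rV[K]_q -> 'rV[K]_q -> 'M[K]_q).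
Variable x0 : 'rV[K]_q.
Hypothesis PsiB : forall s x y, Psi s y - Psi s x = (y - x) *m B s x y.
Hypothesis Psi0 : Psi s0 x0 = 0.
Hypothesis B0 : B s0 x0 x0 \in unitmx.
Local Notation F3 := (filter_prod (filter_prod (nbhs x0) (nbhs x0)) F).
Hypothesis contB : forall r t,
  cont F3 (x0, x0, s0) (fun z => B z.2 z.1.1 z.1.2 r t).
Hypothesis contPsi0 : forall t, cont F s0 (fun s => Psi s x0 0 t).
Hypothesis contPsi : forall s (x : 'rV[K]_q) t, cont (nbhs x) x (fun y => Psi s y 0 t).

Let FF3 : Filter F3. Proof. exact: filter_prod_filter. Qed.

Lemma filter_prod3 (P : S -> 'rV[K]_q -> 'rV[K]_q -> Prop) :
  (\forall z \near F3, P z.2 z.1.1 z.1.2) ->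
  exists2 e : K, 0 < e & \forall s \near F, forall x y, close e x0 x -> close e x0 y -> P s x y.
Proof.
move=> [[A1 A2] /= [[[U1 U2] /= [nU1 nU2] U12] FA2] A12].
have [e1 e10 h1] := nbhs_close nU1; have [e2 e20 h2] := nbhs_close nU2.
have /comparable_leP[le12|lt21] : e1 >=< e2 by rewrite real_comparable // gtr0_real.
  exists e1 => //; apply: filterS FA2 => s A2s x y xx yy.
  apply: (A12 (x, y, s)); split=> //=; apply: (U12 (x, y)); split=> /=.
    exact: h1.
  by apply: h2 => r; exact: lt_le_trans (yy r) le12.
exists e2 => //; apply: filterS FA2 => s A2s x y xx yy.
apply: (A12 (x, y, s)); split=> //=; apply: (U12 (x, y)); split=> /=.
  by apply: h1 => r; exact: lt_trans (xx r) lt21.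
exact: h2.
Qed.

(** Near the base point [B s x y] stays invertible, while two zeros x and y satisfy (y - x) B =
    0. *)
Lemma local_uniqueness : exists2 e : K, 0 < e &
  \forall s \near F, forall x y, close e x0 x -> close e x0 y ->
    Psi s x = 0 -> Psi s y = 0 -> x = y.
Proof.
have [e e0 he] : exists2 e : K, 0 < e & \forall s \near F, forall x y,
    close e x0 x -> close e x0 y -> \det (B s x y) != 0.
  apply: (filter_prod3 (P := fun s x y => \det (B s x y) != 0)).
  apply: (@cont_near_neq0 _ _ F3 _ (x0, x0, s0) (fun z => \det (B z.2 z.1.1 z.1.2))).
    have clC : ring_closed (@cont K _ F3 (x0, x0, s0)) by exact: cont_ring_closed.
    apply: (closed_sum clC) => s; apply: (closedM clC); first exact: closed_cst.
    by apply: (closed_prod clC) => i; exact: contB.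
  by rewrite -unitfE -unitmxE.
exists e => //; apply: filterS he => s detB x y cx cy Px Py.
have := PsiB s x y; rewrite Px Py subrr => /esym/(congr1 (mulmx^~ (invmx (B s x y)))).
rewrite mul0mx mulmxK ?unitmxE ?unitfE ?detB // => /eqP.
by rewrite subr_eq0 => /eqP->.
Qed.

Let A := invmx (B s0 x0 x0).
Let Q : K := q.+1%:R.

Let Q_gt0 : 0 < Q. Proof. by rewrite ltr0n. Qed.

(* The Newton map x - Psi s x A halves distances near x0; its iterates stay in
   a small polydisc, on which Psi s would be bounded below if it had no zero. *)
Lemma local_existence (e : K) : 0 < e ->
  \forall s \near F, exists2 x, close e x0 x & Psi s x = 0.
Proof.
move=> e0; pose E s x y : 'M[K]_q := 1%:M - B s x y *m A.
(* [E] is the factor by which the Newton map changes differences. Entries below 1 / (2(q + 1)) make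
   it halve the maximum norm; q + 1 keeps the bound meaningful for q = 0. *)
have [e1 e10 he1] : exists2 e : K, 0 < e & \forall s \near F, forall x y,
    close e x0 x -> close e x0 y -> forall rt : 'I_q * 'I_q, `|E s x y rt.1 rt.2| < (2 * Q)^-1.
  apply: (filter_prod3 (P := fun s x y => forall rt : 'I_q * 'I_q, `|E s x y rt.1 rt.2| < (2 * Q)^-1)).
  apply: filter_forall => -[r t] /=.
  have E0 : E s0 x0 x0 = 0 by rewrite /E mulmxV // subrr.
  have clC : ring_closed (@cont K _ F3 (x0, x0, s0)) by exact: cont_ring_closed.
  have cE : cont F3 (x0, x0, s0) (fun z => E z.2 z.1.1 z.1.2 r t).
    apply: (@closed_ext K _ (cont F3 (x0, x0, s0)) (fun z => (1%:M : 'M[K]_q) r t - \sum_j B z.2 z.1.1 z.1.2 r j * A j t)).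
      by move=> z; rewrite !mxE.
    apply: (closedB clC); first exact: closed_cst.
    by apply: (closed_sum clC) => j; apply: (closedM clC); [exact: contB | exact: closed_cst].
  have : 0 < (2 * Q)^-1 by rewrite invr_gt0 mulr_gt0.
  move=> /(cont_near_dist _ cE); apply: filterS => z.
  by rewrite /= E0 [X in _ - X]mxE subr0.
have [e2 [e20 lt_e2 lt_e21]] := pos_min e0 e10.
(* With a first step below e2 / 2 the geometric series of steps stays within e2. *)
have near_step : \forall s \near F, forall t, `|(Psi s x0 *m A) 0 t| < e2 / 2.
  apply: filter_forall => t.
  have cP : cont F s0 (fun s => (Psi s x0 *m A) 0 t).
    apply: (@closed_ext K _ (cont F s0) (fun s => \sum_j Psi s x0 0 j * A j t)).
      by move=> s; rewrite mxE.
    have clC : ring_closed (@cont K _ F s0) by exact: cont_ring_closed.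
    by apply: (closed_sum clC) => j; apply: (closedM clC); [exact: contPsi0 | exact: closed_cst].
  have : 0 < e2 / 2 by rewrite divr_gt0.
  move=> /(cont_near_dist _ cP); apply: filterS => s.
  by rewrite /= Psi0 mul0mx [X in _ - X]mxE subr0.
apply: filterS2 he1 near_step => s small_E small_step.
pose T x := x - Psi s x *m A.
have polydisc_close x (e' : K) : polydisc x0 e2 x -> e2 < e' -> close e' x0 x.
  by move=> Dx lt_e r; exact: le_lt_trans (Dx r) lt_e.
have contraction x y (del : K) : close e1 x0 x -> close e1 x0 y -> 0 <= del ->
    (forall r, `|y 0 r - x 0 r| <= del) -> forall t, `|T y 0 t - T x 0 t| <= del / 2.
  move=> cx cy del0 le_del t.
  have -> : T y 0 t - T x 0 t = ((y - x) *m E s x y) 0 t.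
    rewrite /E mulmxBr mulmx1 mulmxA -PsiB mulmxBl /T !mxE; ring.
  rewrite mxE; apply: le_trans (ler_norm_sum _ _ _) _.
  apply: (@le_trans _ _ (\sum_(r < q) del * (2 * Q)^-1)).
    apply: ler_sum => r _; rewrite normrM ler_pM //.
      by rewrite !mxE; exact: le_del.
    exact: ltW (small_E x y cx cy (r, t)).
  rewrite sumr_const card_ord -[_ *+ q]mulr_natr -mulrA; apply: ler_wpM2l => //; rewrite invfM -mulrA.
  rewrite ler_piMr ?invr_ge0 ?ler0n // mulrC ler_pdivrMr // mul1r.
  by rewrite ler_nat.
pose X n := iter n T x0.
have stepX n : (forall r, `|X n.+1 0 r - X n 0 r| <= e2 * 2^-1 ^+ n.+1) /\
    (forall r, `|X n 0 r - x0 0 r| <= e2 * (1 - 2^-1 ^+ n)).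
  elim: n => [|n [IH1 IH2]].
    split=> r; last by rewrite subrr normr0 expr0 subrr mulr0.
    by rewrite /X /= /T !mxE addrC addKr normrN expr1; move: (small_step r); rewrite mxE => /ltW.
  have IH3 r : `|X n.+1 0 r - x0 0 r| <= e2 * (1 - 2^-1 ^+ n.+1).
    rewrite -[X n.+1 0 r](subrK (X n 0 r)) -addrA.
    apply: le_trans (ler_normD _ _) _.
    apply: le_trans (lerD (IH1 r) (IH2 r)) _.
    rewrite -mulrDr ler_wpM2l ?(ltW e20) // exprS.
    by rewrite le_eqVlt; apply/orP; left; apply/eqP; field.
  split=> // r; rewrite [in leRHS]exprS mulrCA mulrC.
  have inD m : (forall r, `|X m 0 r - x0 0 r| <= e2 * (1 - 2^-1 ^+ m)) -> close e1 x0 (X m).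
    move=> le_m; apply: polydisc_close lt_e21 => r'; apply: le_trans (le_m r') _.
    rewrite ler_piMr ?(ltW e20) // gerBl exprn_ge0 // invr_ge0 ler0n.
    by [].
  apply: contraction; [exact: inD IH2 | exact: inD IH3 | | exact: IH1].
  by rewrite mulr_ge0 ?(ltW e20) // exprn_ge0 // invr_ge0 ler0n.
have XD n : polydisc x0 e2 (X n).
  move=> r; have [_ /(_ r) le_n] := stepX n; apply: le_trans le_n _.
  by rewrite ler_piMr ?(ltW e20) // gerBl exprn_ge0 // invr_ge0 ler0n.
apply: contrapT => no_zero.
have Psi_neq0 x : polydisc x0 e2 x -> exists t, Psi s x 0 t != 0.
  move=> Dx; apply: contrapT => all0; apply: no_zero; exists x.
    exact: polydisc_close.
  apply/rowP => t; rewrite [RHS]mxE; apply/eqP; apply: contrapT => /negP nz.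
  by apply: all0; exists t.
have [c c0 lower] : exists2 c : K, 0 < c &
    forall x, polydisc x0 e2 x -> exists t, c < `|Psi s x 0 t|.
  (* Compactness gives a uniform lower bound: near each point of the polydisc some component exceeds
     every sufficiently small constant. *)
  have := @polydisc_compact K q x0 e2 cK => /compact_near_coveringP.
  move=> /(_ K (nbhs (0 : K)) (fun c x => exists t, `|c| < `|Psi s x 0 t|)) H.
  have {H} : \forall c \near nbhs (0 : K), polydisc x0 e2 `<=` (fun x => exists t, `|c| < `|Psi s x 0 t|).
    apply: H => x Dx; have [t nz] := Psi_neq0 x Dx.
    have h0 : 0 < `|Psi s x 0 t| / 2 by rewrite divr_gt0 ?normr_gt0.
    exists ([set y | `|Psi s y 0 t - Psi s x 0 t| < `|Psi s x 0 t| / 2],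
            [set c : K | `|c| < `|Psi s x 0 t| / 2]) => /=.
      split; first exact: (cont_near_dist _ (@contPsi s x t) h0).
      apply/nbhs_ballP; exists (`|Psi s x 0 t| / 2) => //= c.
      by rewrite /ball /= sub0r normrN.
    move=> [y c] /= [ly lc]; exists t.
    have := ler_distD (Psi s y 0 t) (Psi s x 0 t) 0; rewrite !subr0 distrC => le1.
    rewrite -(ltrD2l (`|Psi s x 0 t| / 2)).
    apply: lt_le_trans (_ : `|Psi s x 0 t| <= _).
      by rewrite [ltRHS]splitr ltrD2l.
    by apply: le_trans le1 _; rewrite lerD2r ltW.
  move=> /nbhs_ballP[c0 /= c00 hc0]; exists (c0 / 2); first by rewrite divr_gt0.
  move=> x Dx; have [|t lt_t] := hc0 (c0 / 2) _ x Dx.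
    rewrite /ball /= sub0r normrN gtr0_norm ?divr_gt0 //.
    by rewrite ltr_pdivrMr // ltr_pMr // ltr1n.
  by exists t; rewrite gtr0_norm ?divr_gt0 in lt_t.
(* The value of [Psi s] at [X n] is the n-th Newton step times the matrix at the base point, whose
   size M bounds; for large n it falls below the lower bound c. *)
pose M := 1 + \sum_r \sum_t `|B s0 x0 x0 r t|.
have M0 : 0 < M.
  by rewrite ltr_pwDl // sumr_ge0 // => r _; rewrite sumr_ge0.
have [n lt_n] := sK (divr_gt0 c0 (mulr_gt0 e20 M0)).
have [t] := lower _ (XD n); apply/negP; rewrite -real_leNgt ?normr_real ?gtr0_real //.
have -> : Psi s (X n) = (X n - X n.+1) *m B s0 x0 x0.
  by rewrite /X /= /T opprB addrC subrK -mulmxA mulVmx // mulmx1.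
rewrite mxE; apply: le_trans (ler_norm_sum _ _ _) _.
have [le_n _] := stepX n.
apply: (@le_trans _ _ (e2 * 2^-1 ^+ n * M)); last first.
  by rewrite mulrAC -ler_pdivlMl ?mulr_gt0 // mulrC ltW.
apply: (@le_trans _ _ (\sum_r e2 * 2^-1 ^+ n * `|B s0 x0 x0 r t|)).
  apply: ler_sum => r _; rewrite normrM ler_wpM2r //.
  have -> : (X n - X n.+1) 0 r = X n 0 r - X n.+1 0 r by rewrite mxE [X in _ + X]mxE.
  rewrite distrC.
  apply: le_trans (le_n r) _; rewrite ler_wpM2l ?(ltW e20) // exprS.
  by rewrite ler_piMl ?exprn_ge0 ?invr_ge0 ?ler0n // invf_le1 ?ler1n.
rewrite -mulr_sumr ler_wpM2l ?mulr_ge0 ?(ltW e20) ?exprn_ge0 ?invr_ge0 ?ler0n //.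
rewrite /M ler_wpDl // ?ler01 //; apply: ler_sum => r _.
by rewrite (bigD1 t) //= lerDl sumr_ge0.
Qed.

End ImplicitFunction.

(** * Local constancy of the number of lines *)

Section Counting.
Variable T : Type.
Implicit Types (A : set T) (N : nat).

Definition has_count N A : Prop :=
  exists w : 'I_N -> T, injective w /\ forall V, A V <-> exists i, V = w i.

Lemma has_countP N A : has_count N A <-> (A #= `I_N)%card.
Proof.
split=> [[w [inj_w Aw]]|/card_set_bijP[f [fA inj_f surj_f]]]; last first.
  have /choice[w hw] : forall i : 'I_N, exists V, A V /\ f V = i.
    by move=> i; have [V AV fV] := surj_f i (ltn_ord i); exists V.
  exists w; split=> [i j eq_w|V].
    by apply: val_inj; rewrite /= -(hw i).2 -(hw j).2 eq_w.
  split=> [AV|[i ->]]; last exact: (hw i).1.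
  exists (Ordinal (fA V AV)); apply: inj_f; rewrite ?inE //; first exact: (hw _).1.
  by rewrite (hw _).2.
pose f V : nat := if pselect (exists i, V = w i) is left e then projT1 (cid e) else 0%N.
have fw i : f (w i) = i.
  rewrite /f; case: pselect => [e|[]]; last by exists i.
  by have /inj_w <- := projT2 (cid e).
apply/card_set_bijP; exists f; split.
- by move=> _ /Aw[i ->]; rewrite /= fw; exact: ltn_ord.
- by move=> V V'; rewrite !inE => /Aw[i ->] /Aw[j ->]; rewrite !fw => /val_inj->.
- by move=> n /= ltn; exists (w (Ordinal ltn)); [apply/Aw; exists (Ordinal ltn) | rewrite fw].
Qed.

Lemma has_count_le N N' A : has_count N A -> has_count N' A -> (N <= N')%N.
Proof.
move=> [w [inj_w Aw]] [w' [_ Aw']].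
have /choice[sg hsg] : forall i, exists j, w i = w' j.
  by move=> i; apply/Aw'/Aw; exists i.
have inj_sg : injective sg by move=> i j eq_s; apply: inj_w; rewrite !hsg eq_s.
by have := leq_card sg inj_sg; rewrite !card_ord.
Qed.

Lemma has_count_inj N N' A : has_count N A -> has_count N' A -> N = N'.
Proof. by move=> AN AN'; apply/eqP; rewrite eqn_leq !(@has_count_le _ _ A). Qed.

Lemma infinite_sequence A : infinite_set A ->
  exists2 u : nat -> T, injective u & forall n, A (u n).
Proof.
move=> /infiniteP/card_leP[f]; exists (fun n => val (f (to_setT n))).
  move=> m n /val_inj eq_f.
  have : to_setT m = to_setT n by apply: ('inj_f); rewrite ?in_setT.
  by move=> /(congr1 val).
by move=> n; apply/set_mem/valP.
Qed.

End Counting.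

Section LinesOnPencils.
Variables (K : numClosedFieldType).
Hypothesis (cK : compact_discs K) (sK : small_powers K).
Variables (k d : nat).
Hypothesis hd : d.+1 = k.*2.
Local Notation form := (hform K (2 + k) d).
Local Notation u0 := (lshift k (0 : 'I_2)).
Local Notation u1 := (lshift k (1 : 'I_2)).
Implicit Types (f : form) (x y : 'rV[K]_d.+1) (g h : 'S_(2 + k)).

(* Every line on f is a reduced isolated point of the scheme of lines. *)
Definition regular f : Prop := forall W, lines_on f W ->
  exists g x, W = chart_line g x /\ \det (jac (perm_form g f) x) != 0.

Lemma closed_col_perm Z (C : (Z -> K) -> Prop) g h (x : Z -> 'rV[K]_d.+1) (u v : K) j :
  ring_closed C -> (forall r, C (fun z => x z 0 r)) ->
  C (fun z => col_perm h^-1%g (col_perm g (chart_pt k (x z) u v)) 0 j).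
Proof.
move=> clC Cx; apply: (@closed_ext _ _ C (fun z => chart_pt k (x z) u v 0 (g (h^-1%g j)))).
  by move=> z; rewrite !mxE.
by apply: (closed_chart_pt clC) => //; exact: closed_cst.
Qed.

Lemma closed_minor Z (C : (Z -> K) -> Prop) n (w w' : Z -> 'rV[K]_n) i j : ring_closed C ->
  (forall l, C (fun z => w z 0 l)) -> (forall l, C (fun z => w' z 0 l)) ->
  C (fun z => minor (w z) (w' z) i j).
Proof. by move=> clC Cw Cw'; apply: (closedB clC); apply: (closedM clC). Qed.

(** The change of chart is rational with denominator [transition_minor], which is nonzero at [x], so
    it is continuous there. *)
Lemma near_transition g h x y (e : K) : chart_line g x = chart_line h y -> 0 < e ->
  \forall x' \near x, exists2 y', close e y y' & chart_line g x' = chart_line h y'.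
Proof.
move=> eq_line e0.
have clC : ring_closed (@cont K _ (nbhs x) x) by exact: cont_ring_closed.
have Cx r : cont (nbhs x) x (fun x' => x' 0 r) by exact: cont_coord.
have min0 := transition_minor_neq0 eq_line.
pose w u v x' := col_perm h^-1%g (col_perm g (chart_pt k x' u v)).
have Cmin i j : cont (nbhs x) x (fun x' : 'rV[K]_d.+1 => minor (w 1 0 x') (w 0 1 x') i j).
  by apply: (closed_minor i j clC) => l; exact: closed_col_perm.
have near0 : \forall x' \near x, transition_minor g h x' != 0.
  by apply: (cont_near_neq0 _ (Cmin u0 u1)) min0.
have near_e : \forall x' \near x, forall r, `|transition g h x' 0 r - y 0 r| < e.
  apply: (filter_forall (nbhs_filter x)) => r.
  have Ct : cont (nbhs x) x (fun x' => transition g h x' 0 r).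
    pose t x' := if insub r./2 is Some c then
      (if odd r then minor (w 1 0 x') (w 0 1 x') u0 (rshift 2 c)
       else minor (w 1 0 x') (w 0 1 x') (rshift 2 c) u1)
      / minor (w 1 0 x') (w 0 1 x') u0 u1 else 0.
    apply: (@closed_ext _ _ (cont (nbhs x) x) t) => [x'|]; first by rewrite [RHS]mxE.
    rewrite /t; case: insubP => [c _ _|_]; last exact: (closed_cst clC).
    by apply: cont_div => //; case: (odd r); exact: Cmin.
  by rewrite -(transitionE hd eq_line); exact: (cont_near_dist _ Ct e0).
apply: filterS2 near0 near_e => x' m0 lt_e; exists (transition g h x') => //.
exact: chart_line_transition.
Qed.

Lemma nbhs_prod_close x y (P : 'rV[K]_d.+1 -> 'rV[K]_d.+1 -> Prop) :
  (\forall z \near filter_prod (nbhs x) (nbhs y), P z.1 z.2) ->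
  exists2 e : K, 0 < e & forall x' y', close e x x' -> close e y y' -> P x' y'.
Proof.
move=> [[U1 U2] /= [nU1 nU2] U12].
have [e1 e10 h1] := nbhs_close nU1; have [e2 e20 h2] := nbhs_close nU2.
have [e [e0 lt1 lt2]] := pos_min e10 e20.
exists e => // x' y' cx cy; apply: (U12 (x', y')); split => /=.
  by apply: h1 => r; exact: lt_trans (cx r) lt1.
by apply: h2 => r; exact: lt_trans (cy r) lt2.
Qed.

(** The Grassmannian is Hausdorff. *)
Lemma lines_separated g h x y : chart_line g x != chart_line h y ->
  exists2 e : K, 0 < e & forall x' y', close e x x' -> close e y y' ->
    chart_line g x' != chart_line h y'.
Proof.
move=> /(neq_chart_line)[c [b neq_w]].
pose w (x' : 'rV[K]_d.+1) := col_perm h^-1%g (col_perm g (chart_pt k x' b%:R (~~ b)%:R)).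
pose D x' y' := w x' 0 (rshift 2 c) - slope y' c (w x' 0 u0) (w x' 0 u1).
have [e e0 he] : exists2 e : K, 0 < e & forall x' y', close e x x' -> close e y y' ->
    D x' y' != 0.
  apply: (nbhs_prod_close (P := fun x' y' => D x' y' != 0)).
  pose F := filter_prod (nbhs x) (nbhs y).
  have clC : ring_closed (@cont K _ F (x, y)) by exact: cont_ring_closed.
  have Cw j : cont F (x, y) (fun z => w z.1 0 j).
    by apply: (closed_col_perm _ _ _ _ _ clC) => r; exact: cont_prod_coord.
  apply: (@cont_near_neq0 _ _ F _ (x, y) (fun z => D z.1 z.2)).
    apply: (closedB clC) => //; apply: (closedD clC); apply: (closedM clC) => //.
      apply: (@cvg_comp _ _ _ snd (fun y' : 'rV[K]_d.+1 => y' 0 _) _ (nbhs y)).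
        exact: cvg_snd.
      exact: coord_continuous.
    apply: (@cvg_comp _ _ _ snd (fun y' : 'rV[K]_d.+1 => y' 0 _) _ (nbhs y)).
      exact: cvg_snd.
    exact: coord_continuous.
  by rewrite /D subr_eq0.
exists e => // x' y' cx cy; apply/(neq_chart_line); exists c, b.
by have := he x' y' cx cy; rewrite /D subr_eq0.
Qed.

Variables (f0 f1 : form).
Local Notation F s := (f0 + s *: f1).

Definition sect g (s : K) x := section_vec (perm_form g f0 + s *: perm_form g f1) x.

Lemma sectP g s x : lines_on (F s) (chart_line g x) <-> sect g s x = 0.
Proof.
have -> : lines_on (F s) (chart_line g x) <->
    forall w, w \in chart_line g x -> evalf (F s) w = 0.
  by split=> [[]//|]; split=> //; exact: dim_chart_line.
rewrite chart_vanish perm_formD perm_formZ; split=> [f_0|/rowP f_0 t].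
  by apply/rowP => t; rewrite !mxE.
by have := f_0 t; rewrite !mxE.
Qed.

Lemma cont_id (s0 : K) : cont (nbhs s0) s0 (fun s => s).
Proof. exact: cvg_id. Qed.

Lemma cont_sect g (s : K) x t : cont (nbhs x) x (fun y => sect g s y 0 t).
Proof.
have clC : ring_closed (@cont K _ (nbhs x) x) by exact: cont_ring_closed.
by apply: (closed_section _ _ clC) => [|r]; [exact: closed_cst | exact: cont_coord].
Qed.

Lemma cont_sect_param g (s : K) x t : cont (nbhs s) s (fun s => sect g s x 0 t).
Proof.
have clC : ring_closed (@cont K _ (nbhs s) s) by exact: cont_ring_closed.
by apply: (closed_section _ _ clC) => [|r]; [exact: cont_id | exact: closed_cst].
Qed.

Section AtParameter.
Variable s0 : K.

Let Fs0 : Filter (nbhs s0). Proof. exact: nbhs_filter. Qed.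

Lemma near_no_line g x : ~ lines_on (F s0) (chart_line g x) ->
  \forall z \near filter_prod (nbhs x) (nbhs s0), ~ lines_on (F z.2) (chart_line g z.1).
Proof.
move=> no_line.
have [t nz] : exists t, sect g s0 x 0 t != 0.
  apply: contrapT => all0; apply: no_line; apply/sectP/rowP => t.
  rewrite [RHS]mxE; apply/eqP; apply: contrapT => /negP nz.
  by apply: all0; exists t.
pose G := filter_prod (nbhs x) (nbhs s0).
have clC : ring_closed (@cont K _ G (x, s0)) by exact: cont_ring_closed.
have Ct : cont G (x, s0) (fun z => sect g z.2 z.1 0 t).
  apply: (closed_section _ _ clC) => [|r]; last exact: cont_prod_coord.
  exact: cvg_snd.
have FG : Filter G by exact: filter_prod_filter.
have := cont_near_neq0 FG Ct nz; apply: (@filterS _ G FG) => z nz' /sectP sect0.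
by move: nz'; rewrite sect0 mxE eqxx.
Qed.

(** The unit polydiscs of the finitely many charts are compact and cover the Grassmannian, so a
    condition that holds eventually near each line holds eventually for all lines. *)
Lemma near_all_lines (I : Type) (G : set_system I) (P : I -> {vspace 'rV[K]_(2 + k)} -> Prop) :
  Filter G ->
  (forall g x, \forall x' \near x & i \near G, P i (chart_line g x')) ->
  \forall i \near G, forall W : {vspace 'rV[K]_(2 + k)}, \dim W = 2%N -> P i W.
Proof.
move=> FG hP.
have cover g : \forall i \near G, forall x, polydisc 0 1 x -> P i (chart_line g x).
  have /compact_near_coveringP := @polydisc_compact K d.+1 0 1 cK.
  by move=> /(_ I G (fun i x => P i (chart_line g x)) FG); apply=> x _; exact: hP.
apply: filterS (filter_forall _ cover) => i Pi W /(chart_cover hd)[g [x [-> x1]]].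
by apply: Pi => r; rewrite mxE subr0; exact: x1.
Qed.

Hypothesis regular_s0 : regular (F s0).

Lemma regular_chart W : lines_on (F s0) W -> exists g x, W = chart_line g x /\
  (exists2 e : K, 0 < e & \forall s \near s0, forall x1 x2, close e x x1 -> close e x x2 ->
     lines_on (F s) (chart_line g x1) -> lines_on (F s) (chart_line g x2) -> x1 = x2) /\
  (forall e : K, 0 < e -> \forall s \near s0, exists2 x', close e x x' &
     lines_on (F s) (chart_line g x')).
Proof.
move=> FW; have [g [x [WE jac0]]] := regular_s0 FW.
have [B [PsiB B0 contB]] := pencil_difference hd (perm_form g f0) (perm_form g f1).
have sect0 : sect g s0 x = 0 by apply/sectP; rewrite -WE.
have Bunit : B s0 x x \in unitmx.
  by rewrite B0 unitmxE unitfE -perm_formZ -perm_formD.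
pose F3 := filter_prod (filter_prod (nbhs x) (nbhs x)) (nbhs s0).
have cB r t : cont F3 (x, x, s0) (fun z => B z.2 z.1.1 z.1.2 r t).
  have clC : ring_closed (@cont K _ F3 (x, x, s0)) by exact: cont_ring_closed.
  apply: (contB _ (@cont K _ F3 (x, x, s0)) snd (fst \o fst) (snd \o fst)) => // [|r'|r'].
  - exact: cvg_snd.
  - apply: (@cvg_comp _ _ _ fst (fun z : 'rV[K]_d.+1 * 'rV[K]_d.+1 => z.1 0 r') _
      (filter_prod (nbhs x) (nbhs x))); first exact: cvg_fst.
    exact: (@cont_prod_coord K d.+1 _ (nbhs x) x x r').
  - apply: (@cvg_comp _ _ _ fst (fun z : 'rV[K]_d.+1 * 'rV[K]_d.+1 => z.2 0 r') _
      (filter_prod (nbhs x) (nbhs x))); first exact: cvg_fst.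
    apply: (@cvg_comp _ _ _ snd (fun y : 'rV[K]_d.+1 => y 0 r') _ (nbhs x)).
      exact: cvg_snd.
    exact: coord_continuous.
exists g, x; split=> //; split.
  have [e e0 he] := local_uniqueness Fs0 PsiB Bunit cB.
  exists e => //; apply: filterS he => s hs x1 x2 c1 c2 /sectP z1 /sectP z2.
  exact: hs.
have c1 t : cont (nbhs s0) s0 (fun s => sect g s x 0 t) by exact: cont_sect_param.
have c2 (s : K) y t : cont (nbhs y) y (fun y => sect g s y 0 t) by exact: cont_sect.
move=> e e0; have he := local_existence cK sK Fs0 PsiB sect0 Bunit cB c1 c2 e0.
by apply: filterS he => s [x' cx' /sectP z']; exists x'.
Qed.

(** Given infinitely many distinct lines [u n], each line has a neighbourhood free of [u n] for
    large n: either it is not on the form, or it is an isolated zero. By compactness [u n] would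
    eventually differ from every line, itself included. *)
Lemma regular_finite : finite_set (lines_on (F s0)).
Proof.
apply: contrapT => /infinite_sequence[u inj_u Fu].
have : \forall n \near \oo, forall W : {vspace 'rV[K]_(2 + k)}, \dim W = 2%N -> u n <> W.
  apply: (@near_all_lines _ \oo (fun n W => u n <> W)) => g x.
  have [FW|no_line] := pselect (lines_on (F s0) (chart_line g x)); last first.
    have [[U V] /= [nU nV] UV] := near_no_line no_line.
    exists (U, setT) => /=; first by split=> //; exact: filterT.
    move=> [x' n] /= [Ux' _] eq_u; apply: (UV (x', s0)).
      by split=> //=; exact: nbhs_singleton.
    by rewrite /= -eq_u; exact: Fu.
  have [h [y [WE [[e e0 /nbhs_singleton uniq_e] _]]]] := regular_chart FW.
  have near_x := near_transition WE e0.
  have near_n : \forall n \near \oo, u n <> chart_line g x.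
    have [[m um]|no_m] := pselect (exists m, u m = chart_line g x).
      exists m.+1 => // n /= lt_mn eq_u.
      by have /inj_u e_mn := etrans um (esym eq_u); rewrite e_mn ltnn in lt_mn.
    by exists 0%N => // n _ eq_u; apply: no_m; exists n.
  exists ([set x' | exists2 y', close e y y' & chart_line g x' = chart_line h y'],
          [set n | u n <> chart_line g x]) => //= -[x' n] /= [[y' cy' eq_x'] neq_u] eq_u.
  apply: neq_u; rewrite eq_u eq_x' WE; congr chart_line.
  apply: uniq_e => //.
  - by move=> r; rewrite subrr normr0.
  - by rewrite -eq_x' -eq_u; exact: Fu.
  - by rewrite -WE.
move=> [m _ /(_ m (leqnn m))] /(_ (u m) (Fu m).1).
by [].
Qed.

(* By compactness the lines on F s, s near s0, are close to lines on F s0, and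
   each of the latter extends uniquely. *)
Lemma count_near : exists N, \forall s \near s0, has_count N (lines_on (F s)).
Proof.
have /finite_setP[N /has_countP[w [inj_w hw]]] := regular_finite.
exists N.
have /choice[gx hgx] : forall i, exists gx : 'S_(2 + k) * 'rV[K]_d.+1,
    w i = chart_line gx.1 gx.2 /\
  (exists2 e : K, 0 < e & \forall s \near s0, forall x1 x2, close e gx.2 x1 -> close e gx.2 x2 ->
     lines_on (F s) (chart_line gx.1 x1) -> lines_on (F s) (chart_line gx.1 x2) -> x1 = x2) /\
  (forall e : K, 0 < e -> \forall s \near s0, exists2 x', close e gx.2 x' &
     lines_on (F s) (chart_line gx.1 x')).
  move=> i; have [|g [x hx]] := @regular_chart (w i); first by apply/hw; exists i.
  by exists (g, x).
pose L i (x : 'rV[K]_d.+1) := chart_line (gx i).1 x.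
have close_le (e e' : K) x y : e <= e' -> close e x y -> close e' x y.
  by move=> le_e cxy r; exact: lt_le_trans (cxy r) le_e.
have finite_min (J : finType) (e : J -> K) : (forall j, 0 < e j) ->
    exists2 e' : K, 0 < e' & forall j, e' <= e j.
  move=> e0; suff [e' e'0 le_e'] : exists2 e' : K, 0 < e' & forall j, j \in enum J -> e' <= e j.
    by exists e' => // j; apply: le_e'; rewrite mem_enum.
  elim: (enum J) => [|j r [e' e'0 le_e']]; first by exists 1; rewrite ?ltr01.
  have [c [c0 lt1 lt2]] := pos_min (e0 j) e'0.
  exists c => // j'; rewrite inE => /orP[/eqP->|/le_e']; first exact: ltW.
  exact: le_trans (ltW lt2).
have [e1 e10 uniq_e1] : exists2 e : K, 0 < e & forall i, \forall s \near s0, forall x1 x2,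
    close e (gx i).2 x1 -> close e (gx i).2 x2 ->
    lines_on (F s) (L i x1) -> lines_on (F s) (L i x2) -> x1 = x2.
  have /choice[ei hei] : forall i, exists e : K, 0 < e /\ \forall s \near s0, forall x1 x2,
      close e (gx i).2 x1 -> close e (gx i).2 x2 ->
      lines_on (F s) (L i x1) -> lines_on (F s) (L i x2) -> x1 = x2.
    by move=> i; have [_ [[e e0 he] _]] := hgx i; exists e.
  have [e e0 le_e] := finite_min _ ei (fun i => (hei i).1).
  exists e => // i; apply: filterS (hei i).2 => s hs x1 x2 c1 c2.
  by apply: hs; exact: close_le (le_e i) _.
have [e2 e20 sep_e2] : exists2 e : K, 0 < e & forall i j, i != j -> forall x1 x2,
    close e (gx i).2 x1 -> close e (gx j).2 x2 -> L i x1 != L j x2.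
  have /choice[ei hei] : forall ij : 'I_N * 'I_N, exists e : K, 0 < e /\
      (ij.1 != ij.2 -> forall x1 x2,
        close e (gx ij.1).2 x1 -> close e (gx ij.2).2 x2 -> L ij.1 x1 != L ij.2 x2).
    move=> [i j] /=; have [->|neq_ij] := eqVneq i j; first by exists 1; rewrite ltr01.
    have [|e e0 he] := @lines_separated (gx i).1 (gx j).1 (gx i).2 (gx j).2.
      by rewrite -(hgx i).1 -(hgx j).1 (inj_eq inj_w).
    by exists e; split=> // _.
  have [e e0 le_e] := finite_min _ ei (fun ij => (hei ij).1).
  exists e => // i j neq_ij x1 x2 c1 c2.
  by apply: (hei (i, j)).2 => //; exact: close_le (le_e (i, j)) _.
have [e [e0 lt_e1 lt_e2]] := pos_min e10 e20.
have near_uniq : \forall s \near s0, forall i x1 x2,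
    close e1 (gx i).2 x1 -> close e1 (gx i).2 x2 ->
    lines_on (F s) (L i x1) -> lines_on (F s) (L i x2) -> x1 = x2.
  by apply: (filter_forall Fs0); exact: uniq_e1.
have near_exist : \forall s \near s0, forall i, exists2 x', close e (gx i).2 x' &
    lines_on (F s) (L i x').
  by apply: (filter_forall Fs0) => i; exact: (hgx i).2.2.
have near_cover : \forall s \near s0, forall W : {vspace 'rV[K]_(2 + k)}, \dim W = 2%N ->
    lines_on (F s) W -> exists i, exists2 x', close e (gx i).2 x' & W = L i x'.
  apply: (@near_all_lines _ (nbhs s0) (fun s W => lines_on (F s) W ->
    exists i, exists2 x', close e (gx i).2 x' & W = L i x')) => g x.
  have [FW|no_line] := pselect (lines_on (F s0) (chart_line g x)); last first.
    by apply: filterS (near_no_line no_line) => z no_z.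
  have [i wi] := (hw _).1 FW.
  have eq_line := etrans wi (hgx i).1.
  exists ([set x' | exists2 y', close e (gx i).2 y' & chart_line g x' = L i y'], setT) => /=.
    split; last exact: filterT.
    exact: near_transition.
  by move=> [x' s] /= [[y' cy' eq_x'] _] _; exists i, y'.
apply: filterS3 near_uniq near_exist near_cover => s uniq_s exist_s cover_s.
have /choice[y hy] : forall i, exists x', close e (gx i).2 x' /\ lines_on (F s) (L i x').
  by move=> i; have [x' cx' lx'] := exist_s i; exists x'.
exists (fun i => L i (y i)); split=> [i j eq_L|V].
  apply/eqP; apply/negPn/negP => /sep_e2 sep.
  have := sep (y i) (y j) (close_le _ _ _ _ (ltW lt_e2) (hy i).1)
    (close_le _ _ _ _ (ltW lt_e2) (hy j).1).
  by rewrite eq_L eqxx.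
split=> [FV|[i ->]]; last exact: (hy i).2.
have [i [x' cx' VE]] := cover_s V FV.1 FV; exists i; rewrite VE; congr (L i _).
apply: (uniq_s i); rewrite -?VE //.
- exact: close_le (ltW lt_e1) cx'.
- exact: (close_le _ _ _ _ (ltW lt_e1) (hy i).1).
- exact: (hy i).2.
Qed.

End AtParameter.
End LinesOnPencils.

(** * Topology of the complex numbers *)

Definition punctured_connected (K : numClosedFieldType) : Prop :=
  forall (P : K -> Prop) (s : seq K), 0 \notin s -> 1 \notin s ->
    (forall z, z \notin s -> \forall z' \near z, P z' <-> P z) -> P 0 -> P 1.

Lemma distance_continuous (K : numClosedFieldType) (c : K) :
  continuous (fun x : K => `|x - c|).
Proof.
move=> x; have Fx : Filter (nbhs x) by exact: nbhs_filter.
apply/(@cvgrPdist_lt _ _ _ _ Fx) => e e0; apply/nbhs_ballP; exists e => // y.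
rewrite /ball /= => lt_xy; apply: le_lt_trans (ler_dist_dist _ _) _.
by rewrite opprB addrA subrK.
Qed.

Section ComplexNumbers.
Variable R : realType.
Local Notation K := (complex R : numClosedFieldType).

Lemma complex_norm_gt0 (e : K) : 0 < e -> 0 < complex.Re e /\ e = real_complex R (complex.Re e).
Proof.
by case: e => a b; rewrite ltcE /= => /andP[/eqP -> a0]; split.
Qed.

Lemma norm_le_complex (x : K) :
  `|x| <= real_complex R (`|complex.Re x| + `|complex.Im x|).
Proof.
rewrite normc_def lecR -[leRHS]ger0_norm ?addr_ge0 // -[leRHS]sqrtr_sqr.
rewrite ler_sqrt ?sqr_ge0 // sqrrD !real_normK ?num_real // lerD2r lerDl.
by rewrite mulrn_wge0 // mulr_ge0.
Qed.

Lemma real_complex_continuous (T : Type) (F : set_system T) (FF : Filter F) (f g : T -> R) a b :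
  f @ F --> a -> g @ F --> b ->
  (fun t => (Complex (f t) (g t) : K)) @ F --> (Complex a b : K).
Proof.
move=> fa gb; apply/cvgrPdist_lt => e e0; have [re0 eE] := complex_norm_gt0 e0.
have h0 : 0 < complex.Re e / 2 by rewrite divr_gt0.
have nf : \forall t \near F, `|a - f t| < complex.Re e / 2 by move/cvgrPdist_lt: fa; exact.
have ng : \forall t \near F, `|b - g t| < complex.Re e / 2 by move/cvgrPdist_lt: gb; exact.
apply: (@filterS2 _ F FF _ _ _ _ nf ng) => t lf lg; apply: le_lt_trans (norm_le_complex _) _.
by rewrite eE ltcR /= [ltRHS]splitr ltrD.
Qed.

Lemma Re_continuous : continuous (fun x : K => complex.Re x).
Proof.
move=> x; have Fx : Filter (nbhs (x : K)) by exact: nbhs_filter.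
apply/(@cvgrPdist_lt _ _ _ _ Fx) => e e0; apply/nbhs_ballP; exists (real_complex R e).
  by rewrite /= ltcR.
move=> y; rewrite /ball /= => lt_xy; rewrite -ltcR -raddfB.
exact: le_lt_trans (normc_ge_Re _) lt_xy.
Qed.

(** A disc is closed in the image of a compact real square. *)
Lemma complex_compact_discs : compact_discs K.
Proof.
move=> c r; have [r0|nr0] := boolP (0 <= r); last first.
  rewrite (_ : mkset _ = set0); first exact: compact0.
  by apply/seteqP; split=> x //= le_r; rewrite (le_trans (normr_ge0 _) le_r) in nr0.
pose rho := complex.Re r.
have rE : r = real_complex R rho by rewrite RRe_real // ger0_real.
pose phi (p : R * R) : K := Complex p.1 p.2.
pose a := complex.Re c; pose b := complex.Im c.
have cS : compact (phi @` ([set x | `|x - a| <= rho] `*` [set x | `|x - b| <= rho])).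
  apply: continuous_compact.
    apply: continuous_subspaceT => p; apply: real_complex_continuous.
      exact: cvg_fst.
    exact: cvg_snd.
  have cI u : compact [set x : R | `|x - u| <= rho].
    rewrite (_ : mkset _ = `[u - rho, u + rho]%classic); first exact: segment_compact.
    by apply/seteqP; split=> x /=; rewrite in_itv /= ler_distl.
  exact: compact_setX.
apply: subclosed_compact cS _.
  rewrite (_ : mkset _ = (fun x : K => complex.Re `|x - c|) @^-1` [set y | y <= rho]).
    apply: closed_comp => [x _|]; last exact: closed_le.
    apply: (@cvg_comp _ _ _ (fun x : K => `|x - c|) (fun x : K => complex.Re x) _ (nbhs (`|x - c|))).
      exact: (@distance_continuous K c x).
    exact: Re_continuous.
  by apply/seteqP; split=> x /=; rewrite rE -[`|x - c|]RRe_real ?normr_real // lecR.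
move=> x /= le_x; exists (complex.Re x, complex.Im x); last by case: (x).
have le_Re : `|complex.Re (x - c)| <= rho.
  by rewrite -lecR -rE; exact: le_trans (normc_ge_Re _) le_x.
have le_Im : `|complex.Im (x - c)| <= rho.
  rewrite -lecR -rE -normrN -ReiNIm; apply: le_trans (normc_ge_Re _) _.
  by rewrite normrM [`|'i%C|]normc_def /= expr0n /= add0r expr1n sqrtr1 mulr1.
by move: le_Re le_Im; rewrite !raddfB.
Qed.

Lemma complex_small_powers : small_powers K.
Proof.
move=> e /complex_norm_gt0[e0 ->].
have [n] : exists n, (complex.Re e)^-1 < n%:R.
  by exists (Num.bound (complex.Re e)^-1); apply: archi_boundP; rewrite invr_ge0 ltW.
move=> lt_n; exists n; have -> : (2^-1 : K) ^+ n = real_complex R (2^-1 ^+ n).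
  by rewrite rmorphXn fmorphV rmorph_nat.
rewrite ltcR exprVn invf_plt ?posrE ?exprn_gt0 //.
by apply: lt_trans lt_n _; rewrite -natrX ltr_nat ltn_expl.
Qed.

(* Among the arcs t + i alpha t (1 - t), a point other than 0 and 1 lies on at
   most one. *)
Lemma complex_punctured_connected : punctured_connected K.
Proof.
move=> P s s0 s1 locP P0; apply: contrapT => nP1.
(* The only alpha whose arc can pass through z, for z other than 0 and 1; finitely many values are
   to be avoided. *)
pose bad (z : K) := complex.Im z / (complex.Re z * (1 - complex.Re z)).
have [alpha nbad] : exists alpha : R, alpha \notin map bad s.
  apply: contrapT => all_bad.
  have sub : {subset [seq i%:R | i <- iota 0 (size s).+1] <= map bad s}.
    move=> x _; apply/negP => /negP nx; apply: all_bad; exists x.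
    by case: (x \in _) nx.
  have := uniq_leq_size _ sub; rewrite !size_map size_iota ltnn => H.
  suff : false by []. apply: H; rewrite map_inj_uniq ?iota_uniq //.
  by move=> i j /eqP; rewrite eqr_nat => /eqP.
pose sigma (t : R) : K := Complex t (alpha * (t * (1 - t))).
have sigma_cont t : sigma t' @[t' --> t] --> sigma t.
  apply: real_complex_continuous; first exact: cvg_id.
  apply: cvgM; first exact: cvg_cst.
  apply: cvgM; first exact: cvg_id.
  by apply: cvgB; [exact: cvg_cst | exact: cvg_id].
have good t : sigma t \notin s.
  apply/negP => st; have [t01|] := boolP (t * (1 - t) == 0).
    move: st; rewrite /sigma (eqP t01) mulr0.
    move: t01; rewrite mulf_eq0 subr_eq0 => /orP[/eqP->|/eqP<-].
      exact/negP.
    exact/negP.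
  move=> nz; move/negP: nbad; apply; apply/mapP; exists (sigma t) => //.
  by rewrite /bad /= mulfK.
(* The indicator of P along the arc is continuous with values 0 and 1, so by the intermediate value
   theorem it cannot change. *)
pose f (t : R) : R := if `[< P (sigma t) >] then 1 else 0.
have f_cont : continuous f.
  move=> t; have near_t := sigma_cont t _ (locP _ (good t)).
  have Ft : Filter (nbhs t) by exact: nbhs_filter.
  apply: (@cvg_near_cst _ _ (f t) f (nbhs t) Ft); apply: (@filterS _ _ Ft _ _ _ near_t) => t' /= Pt.
  by rewrite /f; congr (if _ then _ else _); apply/asboolP/asboolP => /Pt.
have [||c _] := @IVT R f 0 1 2^-1 ler01.
- exact: continuous_subspaceT.
- have -> : f 0 = 1.
    by rewrite /f /sigma mul0r mulr0; case: asboolP.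
  have -> : f 1 = 0.
    by rewrite /f /sigma subrr mulr0 mulr0; case: asboolP.
  rewrite min_r ?ler01 // max_l ?ler01 // invr_ge0 ler0n /=.
  by rewrite invf_le1 ?ler1n.
rewrite /f; case: ifP => _ /eqP.
  by rewrite eq_sym invr_eq1 pnatr_eq1.
by rewrite eq_sym invr_eq0 pnatr_eq0.
Qed.

End ComplexNumbers.

(** * Lines on cones and hyperflexes *)

Lemma has_count_fin (T : Type) (I : finType) (A : set T) (w : I -> T) :
  injective w -> (forall V, A V <-> exists i, V = w i) -> has_count #|I| A.
Proof.
move=> inj_w Aw; exists (w \o enum_val); split; first exact: inj_comp enum_val_inj.
move=> V; rewrite Aw; split=> [[i ->]|[i ->]]; last by eexists.
by exists (enum_rank i); rewrite /= enum_rankK.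
Qed.

Lemma has_count_preimage (T T' : Type) N (A : set T) (B : set T') (phi : T' -> T) :
  has_count N A -> (forall V, B V -> A (phi V)) ->
  (forall V V', B V -> B V' -> phi V = phi V' -> V = V') ->
  exists M, has_count M B.
Proof.
move=> [w [inj_w Aw]] BA inj_phi; suff /finite_setP[M BM] : finite_set B.
  by exists M; apply/has_countP.
apply: contrapT => /infinite_sequence[u inj_u Bu].
have /choice[sg hsg] : forall i : 'I_N.+1, exists j : 'I_N, phi (u i) = w j.
  by move=> i; apply/Aw/BA/Bu.
have inj_sg : injective sg.
  move=> i j eq_s; apply/val_inj/inj_u/inj_phi => //.
  by rewrite !hsg eq_s.
by have := leq_card sg inj_sg; rewrite !card_ord ltnn.
Qed.

Lemma roots_of_unity (K : numClosedFieldType) (d : nat) : (0 < d)%N ->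
  exists z : 'I_d -> K, [/\ injective z, forall j, z j ^+ d = 1 &
    forall r, r ^+ d = 1 -> exists j, r = z j].
Proof.
move=> d0; pose p : {poly K} := ('X^d - 1)%R.
have [s ps] := closed_field_poly_normal p.
have p_monic : p \is monic by exact: monicXnsubC.
rewrite (monicP p_monic) scale1r in ps.
have us : uniq s.
  by rewrite -separable.separable_prod_XsubC -ps cyclotomic.separable_Xn_sub_1 // pnatr_eq0 -lt0n.
have szs : size s = d.
  have := congr1 (fun q : {poly K} => size q) ps.
  by rewrite size_XnsubC // size_prod_XsubC => -[].
have rootE r : (r \in s) = (r ^+ d == 1).
  by rewrite -root_prod_XsubC -ps rootE !hornerE subr_eq0.
exists (fun j => s`_j); split=> [i j /eqP|j|r].
- by rewrite nth_uniq ?szs // => /eqP/val_inj.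
- by apply/eqP; rewrite -rootE mem_nth // szs.
- move=> /eqP; rewrite -rootE => rs.
  have lt_r : (index r s < d)%N by rewrite -szs index_mem.
  by exists (Ordinal lt_r); rewrite /= nth_index.
Qed.

(** At the zero (q, -p) of one linear form the other vanishes too, so they are proportional;
    comparing powers shows that the ratio is a d-th root of unity. *)
Lemma proportional_powers (K : numClosedFieldType) (d : nat) (p q p' q' : K) : (0 < d)%N ->
  (p, q) != (0, 0) ->
  (forall u v : K, (u * p' + v * q') ^+ d = (u * p + v * q) ^+ d) ->
  exists r, [/\ r ^+ d = 1, p' = r * p & q' = r * q].
Proof.
move=> d0 pq0 eq_pow.
have cross : q * p' = p * q'.
  have := eq_pow q (- p); rewrite [q * p]mulrC !mulNr subrr expr0n eqn0Ngt d0 => /eqP.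
  by rewrite expf_eq0 d0 subr_eq0 => /eqP.
have powp : p' ^+ d = p ^+ d by have := eq_pow 1 0; rewrite !mul1r !mul0r !addr0.
have powq : q' ^+ d = q ^+ d by have := eq_pow 0 1; rewrite !mul1r !mul0r !add0r.
have [p0|nzp] := eqVneq p 0.
  have nzq : q != 0 by apply: contraNneq pq0 => ->; rewrite p0.
  exists (q' / q); split; last by rewrite divfK.
    by rewrite expr_div_n powq mulfV // expf_neq0.
  move: cross; rewrite p0 mul0r mulr0 => /eqP; rewrite mulf_eq0 (negPf nzq) => /eqP.
  by [].
exists (p' / p); split; first by rewrite expr_div_n powp mulfV // expf_neq0.
  by rewrite divfK.
by rewrite mulrAC [p' * q]mulrC cross mulrAC mulfV // mul1r.
Qed.

Section FlexCount.
Variables (K : numClosedFieldType) (k d : nat).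
Hypothesis (hd : d.+1 = k.+1.*2) (k0 : (0 < k)%N).
Variable f : hform K (2 + k) d.
Hypothesis reg : regular_flex f.
Local Notation up := (widen_ord (leqnSn _)).

Let d0 : (0 < d)%N. Proof. by lia. Qed.

Lemma dim_extend (a b : 'rV[K]_(2 + k)) (p q : K) : \dim (plane a b) = 2%N ->
  \dim (plane (extend a p) (extend b q)) = 2%N.
Proof.
move=> /plane_minor[i [j m0]]; apply: (@dim_plane _ _ _ _ (up i) (up j)).
by rewrite /minor !extend_up.
Qed.

Lemma drop_plane (a b : 'rV[K]_(2 + k)) (p q : K) x :
  x \in plane a b <-> exists2 w, w \in plane (extend a p) (extend b q) & drop w = x.
Proof.
split=> [/mem_plane[u [v ->]]|[w /mem_plane[u [v ->]] <-]].
  exists (u *: extend a p + v *: extend b q); first by apply/mem_plane; exists u, v.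
  by rewrite drop_comb !drop_extend.
by rewrite drop_comb !drop_extend; apply/mem_plane; exists u, v.
Qed.

Lemma plane_coord (a b : 'rV[K]_(2 + k)) (u v u' v' : K) : \dim (plane a b) = 2%N ->
  u *: a + v *: b = u' *: a + v' *: b -> u = u' /\ v = v'.
Proof.
move=> /plane_minor[i [j m0]] eq_c.
have ei := congr1 (fun w : 'rV[K]_(2 + k) => w 0 i) eq_c.
have ej := congr1 (fun w : 'rV[K]_(2 + k) => w 0 j) eq_c.
rewrite !mxE in ei ej.
split; apply: (mulIf m0); rewrite /minor.
  transitivity ((u * a 0 i + v * b 0 i) * b 0 j - (u * a 0 j + v * b 0 j) * b 0 i).
    by ring.
  by rewrite ei ej; ring.
transitivity ((u * a 0 j + v * b 0 j) * a 0 i - (u * a 0 i + v * b 0 i) * a 0 j).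
  by ring.
by rewrite ei ej; ring.
Qed.

(* A line on the cone projects to a hyperflex, and the lines over a hyperflex on
   which f restricts to s^d are the graphs of the d multiples r s with r^d = 1. *)
Lemma flex_count N : has_count N (lines_on (cone f)) ->
  exists M, has_count M (hyperflexes f) /\ N = (d * M)%N.
Proof.
move=> count_lines; have [z [inj_z zd zall]] := roots_of_unity K d0.
pose data (W : {vspace 'rV[K]_(2 + k)}) (t : ('rV[K]_(2 + k) * 'rV[K]_(2 + k)) * (K * K)) :=
  [/\ \dim (plane t.1.1 t.1.2) = 2%N, W = plane t.1.1 t.1.2, t.2 != (0, 0) &
    forall u v : K, evalf f (u *: t.1.1 + v *: t.1.2) = (u * t.2.1 + v * t.2.2) ^+ d].
(* A basis and a linear form are fixed for each hyperflex; other subspaces get zeros as a dummy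
   value. *)
have /choice[dat hdat] : forall W, exists t, hyperflexes f W -> data W t.
  move=> W; have [HW|nHW] := pselect (hyperflexes f W); last by exists (0, 0, (0, 0)).
  have [a [b WE]] := planeP HW.1.
  have dim2 : \dim (plane a b) = 2%N by rewrite -WE; exact: HW.1.
  have := HW; rewrite WE => /(hyperflexP _ dim2)[p [q [pq0 fpq]]].
  by exists ((a, b), (p, q)).
pose V W j := plane (extend (dat W).1.1 (z j * (dat W).2.1))
  (extend (dat W).1.2 (z j * (dat W).2.2)).
have V_line W j : hyperflexes f W -> lines_on (cone f) (V W j).
  move=> /hdat[dim2 _ _ fpq]; split; first exact: dim_extend.
  apply: (cone_line f _ _ _ _).2 => u v; rewrite fpq mulrCA [v * (z j * _)]mulrCA -mulrDr.
  by rewrite exprMn zd mul1r.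
have V_inj W W' j j' : hyperflexes f W -> hyperflexes f W' -> V W j = V W' j' ->
    W = W' /\ j = j'.
  move=> HW HW' eqV; have [dim2 WE pq0 _] := hdat W HW; have [_ WE' _ _] := hdat W' HW'.
  have eqW : W = W'.
    apply/vspaceP => x; rewrite WE WE'; apply/idP/idP.
      by move=> /(drop_plane _ _ (z j * (dat W).2.1) (z j * (dat W).2.2));
        rewrite -/(V W j) eqV => /drop_plane.
    by move=> /(drop_plane _ _ (z j' * (dat W').2.1) (z j' * (dat W').2.2));
      rewrite -/(V W' j') -eqV => /drop_plane.
  split=> //; rewrite -eqW in eqV; apply: inj_z.
  have coord (u v c : K) : extend (u *: (dat W).1.1 + v *: (dat W).1.2) c \in V W j' ->
      c = u * (z j' * (dat W).2.1) + v * (z j' * (dat W).2.2).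
    move=> /mem_plane[u' [v' eq_e]]; have := congr1 (fun w => drop w) eq_e.
    rewrite drop_comb !drop_extend => /(plane_coord dim2)[-> ->].
    have := congr1 (fun w : 'rV[K]_(2 + k).+1 => w 0 ord_max) eq_e.
    by rewrite extend_last => ->; rewrite [LHS]mxE [X in X + _]mxE [X in _ + X]mxE !extend_last.
  have ep : z j * (dat W).2.1 = z j' * (dat W).2.1.
    have := coord 1 0 (z j * (dat W).2.1).
    rewrite scale1r scale0r addr0 mul1r mul0r addr0.
    by apply; rewrite -eqV; apply/mem_plane; exists 1, 0; rewrite scale1r scale0r addr0.
  have eq_ : z j * (dat W).2.2 = z j' * (dat W).2.2.
    have := coord 0 1 (z j * (dat W).2.2).
    rewrite scale1r scale0r add0r mul1r mul0r add0r.
    by apply; rewrite -eqV; apply/mem_plane; exists 0, 1; rewrite scale1r scale0r add0r.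
  have [p0|nzp] := eqVneq (dat W).2.1 0; last exact: mulIf nzp _ _ ep.
  have nzq : (dat W).2.2 != 0.
    by apply: contraNneq pq0 => q0; rewrite [_.2]surjective_pairing p0 q0.
  exact: mulIf nzq _ _ eq_.
have V_surj L : lines_on (cone f) L -> exists W j, hyperflexes f W /\ L = V W j.
  move=> FL; have [A [B LE]] := planeP FL.1.
  have [i [j m0]] : exists i j, minor (drop A) (drop B) i j != 0.
    by apply: (drop_line d0 (f := f)); rewrite -LE.
  have dim2 := dim_plane m0; set W := plane (drop A) (drop B) in dim2.
  have LE' : L = plane (extend (drop A) (A 0 ord_max)) (extend (drop B) (B 0 ord_max)).
    by rewrite !extend_drop.
  have HW : hyperflexes f W.
    apply/hyperflexP => //; exists (A 0 ord_max), (B 0 ord_max); split.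
      by apply: (cone_line_root hd k0 reg (a := drop A) (b := drop B)); rewrite -LE'.
    by apply/cone_line; rewrite -LE'; exact: FL.2.
  have [dim2' WE pq0 fpq] := hdat W HW.
  have lift x : x \in W -> exists p, extend x p \in L.
    rewrite /W => /(drop_plane _ _ (A 0 ord_max) (B 0 ord_max)); rewrite -LE' => -[w wL <-].
    by exists (w 0 ord_max); rewrite extend_drop.
  have [p' pL] : exists p, extend (dat W).1.1 p \in L.
    apply: lift; rewrite {2}WE; apply/mem_plane; exists 1, 0.
    by rewrite scale1r scale0r addr0.
  have [q' qL] : exists q, extend (dat W).1.2 q \in L.
    apply: lift; rewrite {2}WE; apply/mem_plane; exists 0, 1.
    by rewrite scale1r scale0r add0r.
  have LE2 : L = plane (extend (dat W).1.1 p') (extend (dat W).1.2 q').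
    by rewrite (eq_plane FL.1 _ pL qL) // dim_extend.
  have [|r [rd pE qE]] := @proportional_powers K d _ _ p' q' d0 pq0.
    move=> u v; rewrite -fpq; apply/esym; move: u v.
    by apply/cone_line; rewrite -LE2; exact: FL.2.
  have [jr rE] := zall r rd; exists W, jr; split=> //.
  by rewrite LE2 pE qE rE.
(* Finiteness of the set of hyperflexes: one fixed root of unity embeds it into the finite set of
   lines. *)
have [M count_flex] : exists M, has_count M (hyperflexes f).
  apply: (has_count_preimage (phi := fun W => V W (Ordinal d0)) count_lines) => [W HW|W W' HW HW'].
    exact: V_line.
  by move=> /(V_inj _ _ _ _ HW HW')[].
exists M; split=> //; have [w [inj_w hw]] := count_flex.
have Hw i : hyperflexes f (w i) by apply/hw; exists i.
have : has_count #|{: 'I_M * 'I_d}| (lines_on (cone f)).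
  apply: (@has_count_fin _ _ _ (fun ij => V (w ij.1) ij.2)) => [[i j] [i' j'] /= eqV|L].
    by have [/inj_w-> ->] := V_inj _ _ _ _ (Hw i) (Hw i') eqV.
  split=> [/V_surj[W [j [/hw[i ->] ->]]]|[[i j] ->]]; first by exists (i, j).
  exact: V_line.
rewrite card_prod !card_ord mulnC => count_lines'.
exact: has_count_inj count_lines count_lines'.
Qed.

End FlexCount.

(** * Generic counts *)

Section Genericity.
Variables (K : numClosedFieldType) (n d : nat).
Local Notation form := (hform K n d).
Local Notation poly_cond := (mpoly.mpoly #|dmonom n d| K).
Implicit Types (f : form) (G : poly_cond).

Lemma generically_nonroot G (P : form -> Prop) : G != 0 ->
  (forall f, mpoly.meval (coeffs f) G != 0 -> P f) -> generically P.
Proof.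
move=> G0 GP; exists [set f | mpoly.meval (coeffs f) G != 0]; split=> //.
  exists [set G]; apply/seteqP; split=> f /=; first by exists G.
  by move=> [_ ->].
have [y hy] := nonroot G0; exists (form_of y) => /=.
by rewrite form_ofK.
Qed.

Lemma perm_formK (g : 'S_n) f : perm_form g (perm_form g^-1%g f) = f.
Proof.
apply: evalf_inj => v; rewrite !evalf_perm_form; congr evalf.
by apply/rowP => j; rewrite !mxE permKV.
Qed.

(** The product of [G] over all permutations of the variables; it imposes a condition found in one
    chart on all charts at once. *)
Lemma nonroot_all_perm G : G != 0 -> exists2 G', G' != 0 &
  forall f, mpoly.meval (coeffs f) G' != 0 ->
    forall g : 'S_n, mpoly.meval (coeffs (perm_form g f)) G != 0.
Proof.
move=> G0; have [y hy] := nonroot G0.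
have /choice[H hH] : forall g : 'S_n, polyfun (fun f => mpoly.meval (coeffs (perm_form g f)) G).
  by move=> g; apply: (polyfun_perm_form g (h := fun f => mpoly.meval (coeffs f) G)); exists G.
exists (\prod_g H g).
  apply/prodf_neq0 => g _; apply: contraNneq hy => Hg.
  by rewrite -(form_ofK y) -[form_of y](perm_formK g) hH Hg mpoly.meval0.
move=> f; rewrite rmorph_prod => /prodf_neq0 Hf g.
by rewrite hH; exact: Hf.
Qed.

Lemma pencil_polynomial G f0 f1 : exists p : {poly K}, forall s,
  p.[s] = mpoly.meval (coeffs (f0 + s *: f1)) G.
Proof.
pose C (h : K -> K) := exists p : {poly K}, forall s, h s = p.[s].
have clC : ring_closed C.
  split=> [c|h h' [p hp] [p' hp']|h h' [p hp] [p' hp']].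
  - by exists c%:P => s; rewrite hornerC.
  - by exists (p + p') => s; rewrite hornerD hp hp'.
  - by exists (p * p') => s; rewrite hornerM hp hp'.
have [p hp] : C (fun s => mpoly.meval (fun i => (\row_i coeffs (f0 + s *: f1) i) 0 i) G).
  apply: (closed_meval clC) => i.
  exists ((coeffs f0 i)%:P + 'X * (coeffs f1 i)%:P) => s.
  rewrite !hornerE mxE; apply: etrans (mpoly.mcoeffD _ _ _) _.
  by congr (_ + _); exact: mpoly.mcoeffZ.
exists p => s; rewrite -hp; apply: mpoly.meval_eq => i.
by rewrite mxE.
Qed.

End Genericity.

Section ConstantCount.
Variables (K : numClosedFieldType).
Hypotheses (cK : compact_discs K) (sK : small_powers K) (pK : punctured_connected K).
Variables (k d : nat).
Hypothesis hd : d.+1 = k.*2.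
Local Notation form := (hform K (2 + k) d).

Lemma regular_generic : exists2 G : mpoly.mpoly #|dmonom (2 + k) d| K, G != 0 &
  forall f : form, mpoly.meval (coeffs f) G != 0 -> regular f.
Proof.
have [|D [D0 hD]] := @critical_values K k d false; first by rewrite addn0.
have [G G0 hG] := nonroot_all_perm D0; exists G => // f /hG Df W [dim2 fW].
have [g [x [WE _]]] := chart_cover hd dim2; exists g, x; split=> //.
apply: contraNneq (Df g) => /hD-> // u v; rewrite mulr0n evalf_perm_form fW // WE.
by apply/mem_chart_line; exists u, v.
Qed.

Lemma regular_count_constant (G : mpoly.mpoly #|dmonom (2 + k) d| K) (f0 f1 : form) N0 N1 :
  (forall f : form, mpoly.meval (coeffs f) G != 0 -> regular f) ->
  regular f0 -> mpoly.meval (coeffs f1) G != 0 ->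
  has_count N0 (lines_on f0) -> has_count N1 (lines_on f1) -> N0 = N1.
Proof.
move=> hG reg0 G1 count0 count1.
pose F (s : K) : form := f0 + s *: (f1 - f0).
have F0 : F 0 = f0 by rewrite /F scale0r addr0.
have F1 : F 1 = f1 by rewrite /F scale1r addrC subrK.
have [p hp] := pencil_polynomial G f0 (f1 - f0).
have p0 : p != 0.
  by apply: contraNneq G1 => p0; rewrite -F1 -hp p0 horner0.
have [r pr] := closed_field_poly_normal p.
(* The parameter 0 is regular by assumption even if the polynomial vanishes there, as may happen
   when [f0] is a cone. *)
pose s := [seq z <- r | z != 0].
have reg z : z \notin s -> regular (F z).
  rewrite mem_filter negb_and negbK => /orP[/eqP->|nzr]; first by rewrite F0.
  apply: hG; rewrite -hp pr hornerZ mulf_neq0 ?lead_coef_eq0 //.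
  by rewrite -[_ == 0]/(root _ z) root_prod_XsubC.
pose P z := has_count N0 (lines_on (F z)).
suff : P 1 by rewrite /P F1 => /has_count_inj; apply.
apply: (pK (P := P) (s := s)); rewrite /P ?F0 //.
- by rewrite mem_filter eqxx.
- rewrite mem_filter negb_and; apply/orP; right; apply: contra G1 => r1.
  by rewrite -F1 -hp pr hornerZ mulf_eq0 -[X in _ || X]/(root _ 1) root_prod_XsubC r1 orbT.
- move=> z /reg/(count_near cK sK hd)[N near_N].
  have Nz : has_count N (lines_on (F z)) by exact: (nbhs_singleton near_N).
  have Fz : Filter (nbhs z) by exact: nbhs_filter.
  apply: (@filterS _ _ Fz _ _ _ near_N) => z' Nz'.
  by split=> /has_count_inj; [move=> /(_ _ Nz')-> | move=> /(_ _ Nz)->].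
Qed.

End ConstantCount.

Lemma regular_flex_generic (K : numClosedFieldType) (k d : nat) : d.+1 = k.+1.*2 ->
  exists2 G : mpoly.mpoly #|dmonom (2 + k) d| K, G != 0 &
  forall f : hform K (2 + k) d, mpoly.meval (coeffs f) G != 0 -> regular_flex f.
Proof.
move=> hd; have [|D [D0 hD]] := @critical_values K k d true; first by rewrite addn1.
have [G G0 hG] := nonroot_all_perm D0; exists G => // f /hG Df g x fx.
by apply: contraNneq (Df g) => /hD-> // u v; rewrite mulr1n.
Qed.

Lemma lines_flexes_generic (K : numClosedFieldType) (k d : nat) :
  compact_discs K -> small_powers K -> punctured_connected K ->
  (0 < k)%N -> d.+1 = k.+1.*2 ->
  exists Nlines Nflexes : nat,
    [/\ generically (fun F : hform K (2 + k.+1) d => (lines_on F #= `I_Nlines)%card),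
        generically (fun f : hform K (2 + k) d => (hyperflexes f #= `I_Nflexes)%card) &
        Nlines = (d * Nflexes)%N].
Proof.
move=> cK sK pK k0 hd.
have [G G0 hG] := @regular_generic K k.+1 d hd.
have [H H0 hH] := @regular_flex_generic K k d hd.
have [y hy] := nonroot G0; pose F1 : hform K (2 + k.+1) d := form_of y.
have GF1 : mpoly.meval (coeffs F1) G != 0 by rewrite form_ofK.
have has_lines (F : hform K (2 + k.+1) d) : regular F -> exists N, has_count N (lines_on F).
  move=> reg; have [|N near_N] := @count_near K cK sK k.+1 d hd F 0 0.
    by rewrite scaler0 addr0.
  by exists N; have := nbhs_singleton near_N; rewrite scaler0 addr0.
have [N count1] := has_lines F1 (hG F1 GF1).
have count (F : hform K (2 + k.+1) d) : regular F -> has_count N (lines_on F).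
  move=> reg; have [N' countF] := has_lines F reg.
  by rewrite -(@regular_count_constant K cK sK pK k.+1 d hd G F F1 N' N hG reg GF1 countF count1).
have count_flex (f : hform K (2 + k) d) : mpoly.meval (coeffs f) H != 0 ->
    exists M, has_count M (hyperflexes f) /\ N = (d * M)%N.
  move=> /hH reg; apply: (flex_count hd k0 reg); apply: (count (cone f)).
  by move=> W; apply: regular_cone.
(* One suitable form fixes M; for any other, d M' = N = d M with d > 0 gives M' = M. *)
have [y' hy'] := nonroot H0.
have [|M [_ NE]] := count_flex (form_of y'); first by rewrite form_ofK.
exists N, M; split=> //.
  by apply: (generically_nonroot G0) => F /hG/count/has_countP.
apply: (generically_nonroot H0) => f /count_flex[M' [/has_countP countM' NE']].
suff -> : M = M' by [].
by apply/eqP; rewrite -(eqn_pmul2l (m := d)) ?NE' -?NE //; lia.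
Qed.



Theorem theorem5p8 (R : realType) (n d : nat) (hn : (3 <= n)%N)
    (hd : d = (2 * n - 3)%N) :
  exists Nlines Nflexes : nat,
    [/\ generically (fun F : hform (complex R) n.+1 d => (lines_on F #= `I_Nlines)%card),
        generically (fun f : hform (complex R) n d => (hyperflexes f #= `I_Nflexes)%card) &
        Nlines = (d * Nflexes)%N].
Proof.
case: n hn hd => [|[|k]] // hn hd.
apply: (@lines_flexes_generic (complex R) k d).
- exact: complex_compact_discs.
- exact: complex_small_powers.
- exact: complex_punctured_connected.
- by [].
- by lia.
Qed.
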